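(* Consider the online stochastic rewards problem (defined in the context) in the case of decomposable probabilities, i.e. there are numbers $p_i\in[0,1]$ ($i\in I$) and $p_t\in[0,1]$ ($t\in T$) with $p_{it}=p_ip_t$ for every edge $(i,t)\in E$. Then Algorithm 1 (Generalized Perturbed-Greedy) is $(1-1/e)$-competitive against both the clairvoyant benchmark and the fully offline benchmark, i.e. for every such instance its expected total reward is at least $(1-1/e)$ times the optimal expected reward of any clairvoyant policy and at least $(1-1/e)$ times the optimal expected reward of any fully offline policy. Moreover, no online algorithm achieves a competitive ratio larger than $1-1/e$ on this class of instances.
   Context: Online stochastic rewards problem: a bipartite graph $G=(I,T,E)$; offline vertices (resources) $i\in I$ are known in advance, each has a reward $r_i>0$ and unit capacity. Online vertices (arrivals) $t\in T$ arrive one at a time in the order $t=1,2,\dots$; when $t$ arrives, its incident edges $(i,t)\in E$ and their success probabilities $p_{it}\in[0,1]$ are revealed. The algorithm must then irrevocably offer $t$ at most one currently available neighbour $i$. The offer succeeds with probability $p_{it}$, independently of everything else; if it succeeds the algorithm earns $r_i$ and $i$ becomes unavailable forever, otherwise $i$ stays available. The outcome is revealed only after the offer is made. The goal is to maximize expected total reward. Benchmarks: a clairvoyant policy knows $G$, all $p_{it}$ and $r_i$ in advance, processes arrivals in the order $1,2,\dots$, offers each arrival at most one available resource, and learns the outcome of each offer only after making it (it may adapt to past outcomes). A fully offline policy has the same knowledge and constraints but may adaptively choose the order in which arrivals are processed. An algorithm is $\alpha$-competitive against a benchmark if on every instance its expected reward is at least $\alpha$ times the optimal expected reward of the benchmark.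 Algorithm 1 (Generalized Perturbed-Greedy): let $g(y)=e^{y-1}$. Initially all resources are available; draw i.i.d. $y_i\sim U[0,1]$ for each $i\in I$. When $t$ arrives, offer $t$ the available neighbour $i$ maximizing $p_{it}r_i(1-g(y_i))$ (if any); if $t$ accepts, $i$ becomes unavailable. *)

(* Defs.v *)
From Stdlib Require Import Reals Lra List Arith Bool.
Import ListNotations.
Open Scope R_scope.

(* Instances.  Resources are 0 .. nI-1; arrivals are the elements of the  *)
(* list [arrs] in arrival order 0,1,2,...  For an arrival [a],            *)
(*   a i = Some p   iff  (i,t) is an edge with success probability p,     *)
(*   a i = None     iff  (i,t) is not an edge.                            *)
Record inst := mkInst {
  nI : nat;
  rw : nat -> R;
  arrs : list (nat -> option R)
}.

Definition no_edge : nat -> option R := fun _ => None.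

Definition wf_inst (I : inst) : Prop :=
  (forall i, (i < nI I)%nat -> 0 < rw I i) /\
  (forall a, In a (arrs I) -> forall i p, a i = Some p ->
       (i < nI I)%nat /\ 0 <= p <= 1).

Definition decomposable (I : inst) : Prop :=
  exists (pI pT : nat -> R),
    (forall i, (i < nI I)%nat -> 0 <= pI i <= 1) /\
    (forall t, (t < length (arrs I))%nat -> 0 <= pT t <= 1) /\
    (forall t i p, (t < length (arrs I))%nat ->
        nth t (arrs I) no_edge i = Some p -> p = pI i * pT t).

(* Histories of an online process: one entry per processed arrival,       *)
(* (offered resource or None, outcome of the offer).                      *)
Definition hist := list (option nat * bool).

Definition taken (h : hist) (i : nat) : bool :=
  existsb (fun x => match x with
                    | (Some j, true) => Nat.eqb i j
                    | _ => false end) h.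

(* (Randomized) online algorithms, as behavioural strategies: when an     *)
(* arrival comes, the algorithm sees the number of resources, the rewards *)
(* the arrivals revealed so far (the last one being the current one) and  *)
(* its own past offers and their outcomes, and outputs a probability      *)
(* for each option (None = no offer, Some i = offer resource i).          *)
Definition OnlineAlg :=
  nat -> (nat -> R) -> list (nat -> option R) -> hist -> option nat -> R.

Definition valid_alg (alg : OnlineAlg) : Prop :=
  forall n r rev h,
    (forall o, 0 <= alg n r rev h o) /\
    alg n r rev h None +
    fold_right (fun i acc =>
        acc + match (last rev no_edge) i with
              | Some _ => if taken h i then 0 else alg n r rev h (Some i)
              | None => 0 end) 0 (seq 0 n) = 1.

Fixpoint ov (alg : OnlineAlg) (n : nat) (r : nat -> R)
    (revealed rest : list (nat -> option R)) (h : hist) : R :=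
  match rest with
  | [] => 0
  | a :: rest' =>
      let rv := revealed ++ [a] in
      let d := alg n r rv h in
      d None * ov alg n r rv rest' (h ++ [(None, false)]) +
      fold_right (fun i acc =>
        acc + match a i with
              | Some p =>
                  if taken h i then 0 else
                  d (Some i) *
                   (p * (r i + ov alg n r rv rest' (h ++ [(Some i, true)])) +
                    (1 - p) * ov alg n r rv rest' (h ++ [(Some i, false)]))
              | None => 0 end) 0 (seq 0 n)
  end.

Definition online_value (alg : OnlineAlg) (I : inst) : R :=
  ov alg (nI I) (rw I) [] (arrs I) [].

(* Algorithm 1 (Generalized Perturbed-Greedy), for a fixed realisation   *)
(* y of the perturbations: offer the available neighbour maximizing      *)
(* p_it r_i (1 - g(y_i)), g(y) = e^(y-1); ties (a null event) are broken *)
(* towards the smallest index.                                           *)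
Definition gfun (x : R) : R := exp (x - 1).

Definition greedy_choice (n : nat) (r : nat -> R) (y : nat -> R)
    (a : nat -> option R) (h : hist) : option nat :=
  option_map fst
   (fold_left (fun (best : option (nat * R)) i =>
      match a i with
      | Some p =>
          if taken h i then best else
          let w := p * r i * (1 - gfun (y i)) in
          match best with
          | None => Some (i, w)
          | Some (j, b) => if Rlt_dec b w then Some (i, w) else best
          end
      | None => best end) (seq 0 n) None).

Definition dirac (c : option nat) (o : option nat) : R :=
  match c, o with
  | None, None => 1
  | Some i, Some j => if Nat.eqb i j then 1 else 0
  | _, _ => 0
  end.

Definition greedy_alg (y : nat -> R) : OnlineAlg :=
  fun n r rev h => dirac (greedy_choice n r y (last rev no_edge) h).

Definition upd (y : nat -> R) (k : nat) (x : R) : nat -> R :=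
  fun j => if Nat.eqb j k then x else y j.

(* cube_int n f v : the (iterated Riemann) integral of f over [0,1]^n,   *)
(* coordinates 0..n-1, exists and equals v; i.e. v = E[f(y)] for         *)
(* y_0,...,y_{n-1} i.i.d. U[0,1].                                        *)
Fixpoint cube_int (n : nat) (f : (nat -> R) -> R) (v : R) : Prop :=
  match n with
  | O => v = f (fun _ => 0)
  | S m => exists g : R -> R,
      (forall x, 0 <= x <= 1 -> cube_int m (fun y => f (upd y m x)) (g x)) /\
      exists pr : Riemann_integrable g 0 1, RiemannInt pr = v
  end.

(* Clairvoyant benchmark: a deterministic adaptive policy that knows the  *)
(* instance, processes arrivals in order and chooses an offer from the    *)
(* history of outcomes.  An illegal choice counts as "no offer".          *)
Definition ClairPolicy := hist -> option nat.

Fixpoint cv (pol : ClairPolicy) (n : nat) (r : nat -> R)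
    (rest : list (nat -> option R)) (h : hist) : R :=
  match rest with
  | [] => 0
  | a :: rest' =>
      let skip := cv pol n r rest' (h ++ [(None, false)]) in
      match pol h with
      | Some i =>
          match a i with
          | Some p =>
              if (i <? n)%nat && negb (taken h i) then
                p * (r i + cv pol n r rest' (h ++ [(Some i, true)])) +
                (1 - p) * cv pol n r rest' (h ++ [(Some i, false)])
              else skip
          | None => skip
          end
      | None => skip
      end
  end.

Definition clair_value (I : inst) (pol : ClairPolicy) : R :=
  cv pol (nI I) (rw I) (arrs I) [].

(* Fully offline benchmark: the policy adaptively chooses which           *)
(* unprocessed arrival t to process next and which resource to offer it.  *)
(* History entries: (arrival, offer, outcome).  Choosing an invalid       *)
(* (already processed / nonexistent) arrival stops the process; an        *)
(* illegal offer counts as "no offer".                                    *)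
Definition ohist := list (nat * option nat * bool).

Definition otaken (h : ohist) (i : nat) : bool :=
  existsb (fun x => match x with
                    | (_, Some j, true) => Nat.eqb i j
                    | _ => false end) h.

Definition processed (h : ohist) (t : nat) : bool :=
  existsb (fun x => match x with (s, _, _) => Nat.eqb s t end) h.

Definition OffPolicy := ohist -> nat * option nat.

Fixpoint offv (pol : OffPolicy) (n : nat) (r : nat -> R)
    (A : list (nat -> option R)) (fuel : nat) (h : ohist) : R :=
  match fuel with
  | O => 0
  | S f =>
      let (t, o) := pol h in
      if (t <? length A)%nat && negb (processed h t) then
        let a := nth t A no_edge in
        let skip := offv pol n r A f (h ++ [(t, None, false)]) in
        match o with
        | Some i =>
            match a i with
            | Some p =>
                if (i <? n)%nat && negb (otaken h i) then
                  p * (r i + offv pol n r A f (h ++ [(t, Some i, true)])) +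
                  (1 - p) * offv pol n r A f (h ++ [(t, Some i, false)])
                else skip
            | None => skip
            end
        | None => skip
        end
      else 0
  end.

Definition offline_value (I : inst) (pol : OffPolicy) : R :=
  offv pol (nI I) (rw I) (arrs I) (length (arrs I)) [].

(* Main.v *)
From Stdlib Require Import Reals ZArith Lra Lia List Arith Bool.
From Stdlib Require Import Classical ClassicalEpsilon IndefiniteDescription FunctionalExtensionality.
From Coquelicot Require Import Coquelicot.
Require Import Defs.
Import ListNotations.
Open Scope R_scope.

(** Competitiveness.  Since [p_it = p_i p_t], an offer of [i] to [t] can be decided by an
    activity coin of [t] (probability [p_t]), shared by all resources, and by the next unused coin
    of [i] (probability [p_i]).  All policies are coupled through these coins; along a fixed
    outcome, every policy, even a fully offline one, offers [i] to at most as many active arrivals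
    as the coins of [i] allow, and an offer to an active arrival is worth [w_i = p_i r_i].  The
    factor [p_t] does not affect the greedy choice, so along that outcome Algorithm 1 is
    perturbed greedy for vertex-weighted b-matching with one common [y_i] for all copies of [i].
    As the priorities [w_i (1 - g(y_i))] do not depend on the arrival, inserting [i] in a run frees
    only resources of lower priority, hence [i] is exhausted or serves all the neighbours at which
    it outbids the run without it.  The usual primal-dual split [w_i g(y_i) + w_i (1 - g(y_i))] and
    [int_0^Y g = g(Y) - 1/e] give the factor [1 - 1/e].

    The iterated integral over the perturbations is approximated by averages over uniform grids,
    for which the order of the coordinates is immaterial; the error is [O(1/N)] because the
    integrand has bounded variation in each coordinate.

    Hardness.  Against a given algorithm, an adversary repeatedly connects the next arrival to all
    remaining resources and then removes the one that is least likely to be matched. *)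

(** * Bounded variation, iterated integrals and grid averages *)

Fixpoint rsum (n : nat) (f : nat -> R) : R :=
  match n with O => 0 | S m => rsum m f + f m end.

Lemma rsum_ext n f g :
  (forall k, (k < n)%nat -> f k = g k) -> rsum n f = rsum n g.
Proof.
induction n as [|n IH]; intros H; simpl; [reflexivity|].
rewrite IH by (intros; apply H; lia); rewrite H by lia; reflexivity.
Qed.

Lemma rsum_le n f g :
  (forall k, (k < n)%nat -> f k <= g k) -> rsum n f <= rsum n g.
Proof.
induction n as [|n IH]; intros H; simpl; [lra|].
apply Rplus_le_compat; [apply IH; intros|]; apply H; lia.
Qed.

Lemma rsum_plus n f g : rsum n (fun k => f k + g k) = rsum n f + rsum n g.
Proof. induction n as [|n IH]; simpl; [ring|rewrite IH; ring]. Qed.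

Lemma rsum_scal n c f : rsum n (fun k => c * f k) = c * rsum n f.
Proof. induction n as [|n IH]; simpl; [ring|rewrite IH; ring]. Qed.

Lemma rsum_const n c : rsum n (fun _ => c) = INR n * c.
Proof. induction n as [|n IH]; [simpl; ring|rewrite S_INR; simpl; rewrite IH; ring]. Qed.

Lemma rsum_zero n f : (forall k, (k < n)%nat -> f k = 0) -> rsum n f = 0.
Proof.
intros H; rewrite (rsum_ext n f (fun _ => 0)) by auto.
rewrite rsum_const; ring.
Qed.

Lemma rsum_ge0 n f : (forall k, (k < n)%nat -> 0 <= f k) -> 0 <= rsum n f.
Proof.
intros H; rewrite <- (rsum_zero n (fun _ => 0)) by auto; apply rsum_le; auto.
Qed.

Lemma rsum_swap n m f :
  rsum n (fun i => rsum m (fun j => f i j)) = rsum m (fun j => rsum n (fun i => f i j)).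
Proof.
induction n as [|n IH]; simpl.
- symmetry; apply rsum_zero; auto.
- rewrite IH, <- rsum_plus; reflexivity.
Qed.

Lemma rsum_abs n f : Rabs (rsum n f) <= rsum n (fun k => Rabs (f k)).
Proof.
induction n as [|n IH]; simpl; [rewrite Rabs_R0; lra|].
eapply Rle_trans; [apply Rabs_triang|lra].
Qed.

Lemma rsum_term_le n f k :
  (k < n)%nat -> (forall j, (j < n)%nat -> 0 <= f j) -> f k <= rsum n f.
Proof.
induction n as [|n IH]; intros Hk Hf; [lia|simpl].
destruct (Nat.eq_dec k n) as [->|Hne].
- assert (0 <= rsum n f) by (apply rsum_ge0; intros; apply Hf; lia). lra.
- assert (f k <= rsum n f) by (apply IH; [lia|intros; apply Hf; lia]).
  specialize (Hf n); assert (0 <= f n) by (apply Hf; lia). lra.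
Qed.

Lemma rsum_telescope n f : rsum n (fun k => f (S k) - f k) = f n - f O.
Proof. induction n as [|n IH]; simpl; [ring|rewrite IH; ring]. Qed.

(** * Uniform grids, step functions and Riemann integrability *)

Definition gridpt (N k : nat) : R := INR k / INR N.

Lemma gridpt_le N j k : (0 < N)%nat -> (j <= k)%nat -> gridpt N j <= gridpt N k.
Proof.
intros HN Hjk; unfold gridpt, Rdiv; apply Rmult_le_compat_r.
- left; apply Rinv_0_lt_compat, lt_0_INR; lia.
- apply le_INR; lia.
Qed.

Lemma gridpt_0 N : gridpt N 0 = 0.
Proof. unfold gridpt, Rdiv; simpl; ring. Qed.

Lemma gridpt_N N : (0 < N)%nat -> gridpt N N = 1.
Proof. intros HN; unfold gridpt; field; apply not_0_INR; lia. Qed.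

Lemma gridpt_S N k : (0 < N)%nat -> gridpt N (S k) = gridpt N k + / INR N.
Proof. intros HN; unfold gridpt; rewrite S_INR; field; apply not_0_INR; lia. Qed.

Lemma gridpt_range N k : (0 < N)%nat -> (k <= N)%nat -> 0 <= gridpt N k <= 1.
Proof.
intros HN Hk; rewrite <- (gridpt_0 N) at 1; rewrite <- (gridpt_N N HN).
split; apply gridpt_le; lia.
Qed.

Lemma inv_INR_pos N : (0 < N)%nat -> 0 < / INR N.
Proof. intros HN; apply Rinv_0_lt_compat, lt_0_INR; exact HN. Qed.

(* The values at 0 and at the endpoints of the cells are immaterial for the integral. *)
Fixpoint stepf (N : nat) (c : nat -> R) (M : nat) (x : R) : R :=
  match M with
  | O => c O
  | S M' => if Rlt_dec (gridpt N M') x then c M' else stepf N c M' x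
  end.

Lemma stepf_is_RInt N c M :
  (0 < N)%nat -> is_RInt (stepf N c M) 0 (gridpt N M) (rsum M c / INR N).
Proof.
intros HN; induction M as [|M IH].
- rewrite gridpt_0; simpl; replace (0 / INR N) with 0 by (unfold Rdiv; ring).
  apply (is_RInt_point (stepf N c 0)).
- replace (rsum (S M) c / INR N) with (@plus (NormedModule.AbelianMonoid _ R_NormedModule) (rsum M c / INR N) (c M / INR N))
    by (unfold plus; simpl; unfold Rdiv; ring).
  assert (H0 : 0 <= gridpt N M) by (rewrite <- (gridpt_0 N); apply gridpt_le; lia).
  assert (H1 : gridpt N M <= gridpt N (S M)) by (apply gridpt_le; lia).
  apply (is_RInt_Chasles (V := R_NormedModule)) with (gridpt N M).
  + apply is_RInt_ext with (stepf N c M); [|exact IH].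
    intros x; rewrite Rmin_left, Rmax_right by lra; intros Hx; simpl.
    destruct (Rlt_dec (gridpt N M) x); [lra|reflexivity].
  + apply is_RInt_ext with (fun _ => c M).
    * intros x; rewrite Rmin_left, Rmax_right by lra; intros Hx; simpl.
      destruct (Rlt_dec (gridpt N M) x); [reflexivity|lra].
    * replace (c M / INR N) with (scal (gridpt N (S M) - gridpt N M) (c M)).
      { apply (is_RInt_const (V := R_NormedModule)). }
      rewrite gridpt_S by lia; unfold scal; simpl; unfold mult; simpl; unfold Rdiv; ring.
Qed.

(** The cell estimate is assumed on closed cells, so it also covers a grid point, where [stepf]
    takes the value of the cell to its left. *)
Lemma stepf_dominates N f c o M x :
  (0 < N)%nat ->
  (forall k y, (k < N)%nat -> gridpt N k <= y <= gridpt N (S k) -> Rabs (f y - c k) <= o k) ->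
  (M <= N)%nat -> 0 <= x <= gridpt N M ->
  Rabs (f x - stepf N c M x) <= stepf N o M x.
Proof.
intros HN Hcell; induction M as [|M IH]; intros HM Hx.
- rewrite gridpt_0 in Hx; simpl; apply Hcell; [lia|].
  rewrite gridpt_0; assert (H := gridpt_le N 0 1 HN); rewrite gridpt_0 in H.
  split; [lra|]; apply Rle_trans with 0; [lra|apply H; lia].
- simpl; destruct (Rlt_dec (gridpt N M) x) as [Hlt|Hge].
  + apply Hcell; [lia|lra].
  + apply IH; [lia|lra].
Qed.

(** Cauchy criterion: over one pointed subdivision the Riemann sums of [f] and [phi] differ by at
    most that of [psi], so all fine sums of [f] lie near the integral of [phi]. *)
Lemma ex_RInt_squeeze (f : R -> R) :
  (forall eps, 0 < eps -> exists phi psi If Ip,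
     is_RInt phi 0 1 If /\ is_RInt psi 0 1 Ip /\ Ip < eps /\
     forall x, 0 <= x <= 1 -> Rabs (f x - phi x) <= psi x) ->
  ex_RInt f 0 1.
Proof.
intros H.
assert (Hs : sign (1 - 0) = 1) by (apply sign_eq_1; lra).
unfold ex_RInt, is_RInt.
apply (proj1 (filterlim_locally_cauchy (F := Riemann_fine 0 1)
   (fun ptd => scal (sign (1 - 0)) (Riemann_sum f ptd)))).
intros [eps Heps].
(* Three errors below [eps / 6] (the sum of [phi], the sum of [psi], and [Ip] itself) keep each fine
   sum within [eps / 2] of [If]. *)
destruct (H (eps / 6)) as (phi & psi & If & Ip & Hphi & Hpsi & HIp & Hdom); [lra|].
assert (He6 : 0 < eps / 6) by lra.
pose proof (proj1 (filterlim_locally _ _) Hphi (mkposreal _ He6)) as F1.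
pose proof (proj1 (filterlim_locally _ _) Hpsi (mkposreal _ He6)) as F2.
assert (F3 : Riemann_fine 0 1 (fun ptd => pointed_subdiv ptd /\
     SF_h ptd = 0 /\ seq.last (SF_h ptd) (SF_lx ptd) = 1)).
{ unfold Riemann_fine, within. apply filter_forall.
  intros ptd; rewrite Rmin_left, Rmax_right by lra. intros; assumption. }
exists (fun ptd => (ball If (eps / 6) (scal (sign (1 - 0)) (Riemann_sum phi ptd)) /\
   ball Ip (eps/6) (scal (sign (1 - 0)) (Riemann_sum psi ptd))) /\
  (pointed_subdiv ptd /\
     SF_h ptd = 0 /\ seq.last (SF_h ptd) (SF_lx ptd) = 1)).
split.
{ apply filter_and; [apply filter_and|]; assumption. }
assert (Key : forall u, (ball If (eps / 6) (scal (sign (1 - 0)) (Riemann_sum phi u)) /\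
   ball Ip (eps/6) (scal (sign (1 - 0)) (Riemann_sum psi u))) /\
  (pointed_subdiv u /\
     SF_h u = 0 /\ seq.last (SF_h u) (SF_lx u) = 1) ->
   Rabs (Riemann_sum f u - If) < eps / 2).
{ intros u ((B1 & B2) & (P1 & P2 & P3)).
  rewrite Hs in B1, B2.
  unfold ball in B1, B2; simpl in B1, B2; unfold AbsRing_ball, abs, minus, plus, opp in B1, B2;
    simpl in B1, B2; unfold scal in B1, B2; simpl in B1, B2; unfold mult in B1, B2; simpl in B1, B2.
  rewrite Rmult_1_l in B1, B2.
  assert (D : Rabs (Riemann_sum (fun x => minus (f x) (phi x)) u) <= Riemann_sum psi u).
  { apply (Riemann_sum_norm (fun x => minus (f x) (phi x)) psi u P1).
    intros t Ht; apply Hdom; lra. }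
  assert (D' : Rabs (Riemann_sum f u - Riemann_sum phi u) <= Riemann_sum psi u).
  { refine (Rle_trans _ _ _ (Req_le _ _ (f_equal Rabs _)) D).
    symmetry; exact (Riemann_sum_minus (V := R_ModuleSpace) f phi u). }
  apply Rabs_def2 in B1; apply Rabs_def2 in B2; apply Rabs_le_between in D'.
  apply Rabs_def1; lra. }
intros u v Hu Hv; apply Key in Hu; apply Key in Hv.
rewrite Hs; unfold ball; simpl; unfold AbsRing_ball, abs, minus, plus, opp; simpl;
 unfold scal; simpl; unfold mult; simpl.
rewrite !Rmult_1_l.
apply Rabs_def2 in Hu; apply Rabs_def2 in Hv; apply Rabs_def1; lra.
Qed.

(* Bounded variation on [0,1], tested on uniform grids only: unlike sorted-list variations this
   form passes to integrals over the other coordinates by a finite sum argument. *)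
Definition grid_bv (V : R) (f : R -> R) : Prop :=
  forall N (s t : nat -> R), (0 < N)%nat ->
    (forall k, (k < N)%nat -> gridpt N k <= s k <= gridpt N (S k)) ->
    (forall k, (k < N)%nat -> gridpt N k <= t k <= gridpt N (S k)) ->
    rsum N (fun k => Rabs (f (s k) - f (t k))) <= V.

(** The oscillation on a cell need not be attained, while [grid_bv] tests actual points; an
    approximate maximizer stands in for the supremum. *)
Lemma near_sup (E : R -> Prop) (B d : R) :
  0 < d -> (exists x, E x) -> (forall x, E x -> x <= B) ->
  exists x, E x /\ forall y, E y -> y <= x + d.
Proof.
intros Hd Hne Hb.
destruct (completeness E) as (m & Hm1 & Hm2); [exists B; exact Hb|exact Hne|].
destruct (classic (exists x, E x /\ m - d < x)) as [(x & Hx & Hmx)|Hno].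
- exists x; split; [exact Hx|]; intros y Hy; specialize (Hm1 y Hy); lra.
- assert (m <= m - d); [|lra].
  apply Hm2; intros x Hx; apply Rnot_lt_le; intros Hlt; apply Hno; eauto.
Qed.

(** One near-maximizer per cell, with slack [/ INR N], turns the variation bound into cellwise
    errors; the [N] slacks add up to the extra 1. *)
Lemma grid_bv_dominated V f N :
  grid_bv V f -> (0 < N)%nat ->
  exists o : nat -> R, rsum N o <= V + 1 /\
    forall k y, (k < N)%nat -> gridpt N k <= y <= gridpt N (S k) ->
      Rabs (f y - f (gridpt N (S k))) <= o k.
Proof.
intros Hf HN.
(* The grid with a single cell bounds the oscillation on all of [0,1], so the suprema below are
   finite. *)
assert (HB : forall x y, 0 <= x <= 1 -> 0 <= y <= 1 -> Rabs (f x - f y) <= V).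
{ intros x y Hx Hy. specialize (Hf 1%nat (fun _ => x) (fun _ => y)); simpl in Hf.
  rewrite Rplus_0_l in Hf; apply Hf; [lia| |]; intros k Hk; assert (k = O) by lia; subst;
  rewrite gridpt_0, gridpt_N by lia; lra. }
assert (Hex : forall k, exists t, (k < N)%nat -> gridpt N k <= t <= gridpt N (S k) /\
   forall y, gridpt N k <= y <= gridpt N (S k) ->
   Rabs (f y - f (gridpt N (S k))) <= Rabs (f t - f (gridpt N (S k))) + / INR N).
{ intros k. destruct (le_lt_dec N k) as [Hk|Hk]; [exists 0; lia|].
  assert (Hr0 := gridpt_range N k HN ltac:(lia)).
  assert (Hr1 := gridpt_range N (S k) HN ltac:(lia)).
  destruct (near_sup (fun z => exists y, gridpt N k <= y <= gridpt N (S k) /\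
      z = Rabs (f y - f (gridpt N (S k)))) V (/ INR N)) as (z & (t & Ht & ->) & Hz).
  - apply inv_INR_pos; exact HN.
  - eexists; exists (gridpt N k); split; [|reflexivity].
    split; [lra|apply gridpt_le; lia].
  - intros z (y & Hy & ->); apply HB; lra.
  - exists t; intros _; split; [exact Ht|]. intros y Hy; apply Hz; eauto. }
apply functional_choice in Hex; destruct Hex as (t & Ht).
exists (fun k => Rabs (f (t k) - f (gridpt N (S k))) + / INR N); split.
- rewrite rsum_plus, rsum_const, Rinv_r by (apply not_0_INR; lia).
  apply Rplus_le_compat_r; apply Hf; [exact HN| |].
  + intros k Hk; apply Ht; exact Hk.
  + intros k Hk; split; [apply gridpt_le; lia|lra].
- intros k y Hk Hy; apply Ht; assumption.
Qed.

(** The right-endpoint step function approximates [f] up to a step function of integral at most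
    [(V + 1) / INR N]; this yields integrability and the rate at once. *)
Lemma grid_bv_RInt V f :
  grid_bv V f -> exists I, is_RInt f 0 1 I /\
    forall N, (0 < N)%nat ->
      Rabs (I - rsum N (fun k => f (gridpt N (S k))) / INR N) <= (V + 1) / INR N.
Proof.
intros Hf.
assert (HV : 0 <= V).
{ specialize (Hf 1%nat (fun _ => 0) (fun _ => 0)); simpl in Hf.
  rewrite Rplus_0_l, Rminus_diag, Rabs_R0 in Hf; apply Hf; [lia| |];
   intros k Hk; assert (k = O) by lia; subst; rewrite gridpt_0, gridpt_N by lia; lra. }
assert (Hint : ex_RInt f 0 1).
{ apply ex_RInt_squeeze; intros eps Heps.
  destruct (archimed_cor1 (eps / (V + 1))) as (N & HN1 & HN2).
  { apply Rdiv_lt_0_compat; lra. }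
  destruct (grid_bv_dominated V f N Hf HN2) as (o & Ho1 & Ho2).
  exists (stepf N (fun k => f (gridpt N (S k))) N), (stepf N o N),
    (rsum N (fun k => f (gridpt N (S k))) / INR N), (rsum N o / INR N).
  rewrite <- (gridpt_N N HN2).
  repeat split; try (apply stepf_is_RInt; exact HN2).
  - assert (HNp := inv_INR_pos N HN2).
    apply Rle_lt_trans with ((V + 1) * / INR N).
    + apply Rmult_le_compat_r; lra.
    + apply Rmult_lt_reg_r with (/ (V + 1)); [apply Rinv_0_lt_compat; lra|].
      replace ((V + 1) * / INR N * / (V + 1)) with (/ INR N) by (field; split; [lra|apply not_0_INR; lia]).
      exact HN1.
  - intros x Hx; apply stepf_dominates; auto. }
destruct Hint as (I & HI); exists I; split; [exact HI|].
intros N HN.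
destruct (grid_bv_dominated V f N Hf HN) as (o & Ho1 & Ho2).
pose proof (stepf_is_RInt N (fun k => f (gridpt N (S k))) N HN) as H1.
pose proof (stepf_is_RInt N o N HN) as H2.
rewrite (gridpt_N N HN) in H1, H2.
apply Rle_trans with (rsum N o / INR N).
- refine (norm_RInt_le (V := R_NormedModule) (fun x => minus (f x) (stepf N (fun k => f (gridpt N (S k))) N x)) (stepf N o N)
     0 1 _ _ _ _ (is_RInt_minus (V := R_NormedModule) _ _ _ _ _ _ HI H1) H2); [lra|].
  intros x Hx; apply (stepf_dominates N f (fun k => f (gridpt N (S k))) o N x); auto.
  rewrite gridpt_N by exact HN; exact Hx.
- apply Rmult_le_compat_r; [left; apply inv_INR_pos; exact HN|exact Ho1].
Qed.

(** Same recursion as [cube_int], each integral being replaced by the average over the right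
    endpoints of [N] cells. *)
Fixpoint gavg (N n : nat) (f : (nat -> R) -> R) : R :=
  match n with
  | O => f (fun _ => 0)
  | S m => rsum N (fun k => gavg N m (fun y => f (upd y m (gridpt N (S k))))) / INR N
  end.

Definition in_cube (y : nat -> R) : Prop := forall j, 0 <= y j <= 1.

Lemma upd_cube y k x : in_cube y -> 0 <= x <= 1 -> in_cube (upd y k x).
Proof. intros Hy Hx j; unfold upd; destruct (Nat.eqb j k); auto. Qed.

Lemma upd_comm y i j a b : i <> j -> upd (upd y i a) j b = upd (upd y j b) i a.
Proof.
intros Hij; extensionality k; unfold upd.
destruct (Nat.eqb_spec k i), (Nat.eqb_spec k j); congruence.
Qed.

Lemma gavg_le N n f g : (0 < N)%nat ->
  (forall y, in_cube y -> f y <= g y) -> gavg N n f <= gavg N n g.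
Proof.
intros HN; revert f g; induction n as [|n IH]; intros f g H; simpl.
- apply H; intros j; lra.
- apply Rmult_le_compat_r; [left; apply inv_INR_pos; exact HN|].
  apply rsum_le; intros k Hk; apply IH; intros y Hy; apply H, upd_cube; [exact Hy|].
  apply gridpt_range; lia.
Qed.

Lemma gavg_plus N n f g : gavg N n (fun y => f y + g y) = gavg N n f + gavg N n g.
Proof.
revert f g; induction n as [|n IH]; intros f g; simpl; [reflexivity|].
rewrite (rsum_ext N _ _ (fun k _ => IH _ _)), rsum_plus; unfold Rdiv; ring.
Qed.

Lemma gavg_scal N n c f : gavg N n (fun y => c * f y) = c * gavg N n f.
Proof.
revert f; induction n as [|n IH]; intros f; simpl; [reflexivity|].
rewrite (rsum_ext N _ _ (fun k _ => IH _)), rsum_scal; unfold Rdiv; ring.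
Qed.

Lemma gavg_const N n c : (0 < N)%nat -> gavg N n (fun _ => c) = c.
Proof.
intros HN; induction n as [|n IH]; simpl; [reflexivity|].
rewrite IH, rsum_const; field; apply not_0_INR; lia.
Qed.

Lemma gavg_rsum N n M (f : nat -> (nat -> R) -> R) : (0 < N)%nat ->
  gavg N n (fun y => rsum M (fun k => f k y)) = rsum M (fun k => gavg N n (f k)).
Proof.
intros HN; induction M as [|M IH]; simpl; [apply gavg_const; exact HN|].
rewrite <- IH; apply gavg_plus.
Qed.

Lemma gavg_abs N n f : (0 < N)%nat ->
  Rabs (gavg N n f) <= gavg N n (fun y => Rabs (f y)).
Proof.
intros HN; apply Rabs_le; split.
- replace (- gavg N n (fun y => Rabs (f y))) with (gavg N n (fun y => (-1) * Rabs (f y)))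
    by (rewrite gavg_scal; ring).
  apply gavg_le; [exact HN|]; intros y _; pose proof (Rle_abs (- f y)); rewrite Rabs_Ropp in *; lra.
- apply gavg_le; [exact HN|]; intros y _; apply Rle_abs.
Qed.

(* Fubini on the grid: the coordinate [i] may be averaged first. *)
Lemma gavg_coord_ge N n i c f : (0 < N)%nat -> (i < n)%nat ->
  (forall y, in_cube y -> c <= rsum N (fun k => f (upd y i (gridpt N (S k)))) / INR N) ->
  c <= gavg N n f.
Proof.
intros HN; revert f; induction n as [|n IH]; intros f Hi H; [lia|].
destruct (Nat.eq_dec i n) as [->|Hne].
(* Here [i] is the outermost coordinate; its average moves inside the others by linearity. *)
- rewrite <- (gavg_const N n c HN); simpl; unfold Rdiv; rewrite Rmult_comm.
  rewrite <- gavg_rsum, <- gavg_scal by exact HN.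
  apply gavg_le; [exact HN|]; intros y Hy; rewrite Rmult_comm; apply H, Hy.
- simpl. apply Rle_trans with (rsum N (fun _ => c) / INR N).
  + rewrite rsum_const; right; field; apply not_0_INR; lia.
  + apply Rmult_le_compat_r; [left; apply inv_INR_pos; exact HN|].
    apply rsum_le; intros k Hk; apply IH; [lia|]; intros y Hy.
    eapply Rle_trans; [apply (H (upd y n (gridpt N (S k))))|].
    * apply upd_cube; [exact Hy|apply gridpt_range; lia].
    * right; f_equal; apply rsum_ext; intros l _; rewrite upd_comm by lia; reflexivity.
Qed.

Lemma le_of_le_inv_N a b C :
  (forall N, (0 < N)%nat -> a <= b + C / INR N) -> a <= b.
Proof.
intros H; apply Rnot_lt_le; intros Hlt.
destruct (archimed_cor1 ((a - b) / (Rabs C + 1))) as (N & HN1 & HN2).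
{ apply Rdiv_lt_0_compat; [lra|pose proof (Rabs_pos C); lra]. }
specialize (H N HN2).
assert (HC := Rabs_pos C); assert (HC' := Rle_abs C); assert (HNp := inv_INR_pos N HN2).
assert (/ INR N * (Rabs C + 1) < a - b).
{ apply Rmult_lt_reg_r with (/ (Rabs C + 1)); [apply Rinv_0_lt_compat; lra|].
  rewrite Rmult_assoc, Rinv_r, Rmult_1_r by lra; exact HN1. }
unfold Rdiv in H; nra.
Qed.

(** The inner integral [g] inherits the variation bound [V]: its variation sums are limits of
    averages of variation sums of [f] in the outer coordinate. Each coordinate then adds an error
    [(V + 1) / INR N]. *)
Lemma cube_int_exists n V f :
  (forall k y, (k < n)%nat -> grid_bv V (fun x => f (upd y k x))) ->
  exists v, cube_int n f v /\
    forall N, (0 < N)%nat -> Rabs (v - gavg N n f) <= INR n * (V + 1) / INR N.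
Proof.
revert f; induction n as [|n IH]; intros f Hf.
- exists (f (fun _ => 0)); split; [reflexivity|]; intros N HN; simpl.
  rewrite Rminus_diag, Rabs_R0; unfold Rdiv; lra.
- assert (Hx : forall x, exists v, cube_int n (fun y => f (upd y n x)) v /\
    forall N, (0 < N)%nat -> Rabs (v - gavg N n (fun y => f (upd y n x))) <= INR n * (V + 1) / INR N).
  { intros x; apply IH; intros k y Hk N s t HN Hs Ht.
    rewrite (rsum_ext N _ (fun j => Rabs (f (upd (upd y n x) k (s j)) - f (upd (upd y n x) k (t j))))).
    - apply (Hf k (upd y n x)); auto; lia.
    - intros j _; rewrite !(upd_comm y n k) by lia; reflexivity. }
  apply functional_choice in Hx; destruct Hx as (g & Hg).
  assert (Hbv : grid_bv V g).
  { intros M s t HM Hs Ht.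
    (* The test points stay fixed while the inner grid is refined; each of the [2 * M] values of [g]
       is replaced by a grid average. *)
    apply (le_of_le_inv_N _ _ (INR M * (2 * (INR n * (V + 1))))); intros N HN.
    apply Rle_trans with (gavg N n (fun y => rsum M (fun k => Rabs (f (upd y n (s k)) - f (upd y n (t k)))))
        + INR M * (2 * (INR n * (V + 1) / INR N))).
    - rewrite gavg_rsum, <- rsum_const, <- rsum_plus by exact HN.
      apply rsum_le; intros k Hk.
      assert (E1 := proj2 (Hg (s k)) N HN); assert (E2 := proj2 (Hg (t k)) N HN).
      assert (E3 := gavg_abs N n (fun y => f (upd y n (s k)) + -1 * f (upd y n (t k))) HN).
      rewrite gavg_plus, gavg_scal in E3.
      replace (gavg N n (fun y => Rabs (f (upd y n (s k)) - f (upd y n (t k))))) with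
        (gavg N n (fun y => Rabs (f (upd y n (s k)) + -1 * f (upd y n (t k))))).
      2:{ f_equal; extensionality y; f_equal; ring. }
      apply Rabs_le_between in E1; apply Rabs_le_between in E2; apply Rabs_le_between in E3.
      apply Rabs_le; lra.
    - assert (gavg N n (fun y => rsum M (fun k => Rabs (f (upd y n (s k)) - f (upd y n (t k))))) <= V).
      { rewrite <- (gavg_const N n V HN); apply gavg_le; [exact HN|]; intros y _.
        apply (Hf n y); auto. }
      unfold Rdiv; lra. }
  destruct (grid_bv_RInt V g Hbv) as (I & HI & HIN).
  exists I; split.
  + exists g; split; [intros x _; apply Hg|].
    assert (pr : Riemann_integrable g 0 1) by (apply ex_RInt_Reals_0; exists I; exact HI).
    exists pr; rewrite <- RInt_Reals; apply is_RInt_unique; exact HI.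
  + intros N HN; simpl gavg.
    specialize (HIN N HN); rewrite S_INR.
    assert (Rabs (rsum N (fun k => g (gridpt N (S k))) / INR N -
      rsum N (fun k => gavg N n (fun y => f (upd y n (gridpt N (S k))))) / INR N)
       <= INR n * (V + 1) / INR N).
    { replace (rsum N (fun k => g (gridpt N (S k))) / INR N -
      rsum N (fun k => gavg N n (fun y => f (upd y n (gridpt N (S k))))) / INR N) with
      (rsum N (fun k => g (gridpt N (S k)) + -1 * gavg N n (fun y => f (upd y n (gridpt N (S k))))) * / INR N)
        by (rewrite rsum_plus, rsum_scal; unfold Rdiv; ring).
      rewrite Rabs_mult, (Rabs_pos_eq (/ INR N)) by (left; apply inv_INR_pos; exact HN).
      apply Rle_trans with (rsum N (fun _ => INR n * (V + 1) / INR N) * / INR N).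
      - apply Rmult_le_compat_r; [left; apply inv_INR_pos; exact HN|].
        eapply Rle_trans; [apply rsum_abs|]; apply rsum_le; intros k Hk.
        replace (g (gridpt N (S k)) + -1 * gavg N n (fun y => f (upd y n (gridpt N (S k))))) with
        (g (gridpt N (S k)) - gavg N n (fun y => f (upd y n (gridpt N (S k))))) by ring.
        apply Hg; exact HN.
      - rewrite rsum_const; right; field; apply not_0_INR; lia. }
    apply Rabs_le_between in H; apply Rabs_le_between in HIN; apply Rabs_le.
    unfold Rdiv in *; lra.
Qed.

(** * Coins and sample paths *)

(* Coin [(0, t)] decides whether arrival [t] is active (probability p_t); coin [(S i, k)] decides
   the outcome of the [k]-th offer of resource [i] to an active arrival (probability p_i). *)
Definition coin : Type := (nat * nat)%type.

Definition coin_dec (c d : coin) : {c = d} + {c <> d}.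
Proof. decide equality; apply Nat.eq_dec. Defined.

Definition set_coin (w : coin -> bool) (c : coin) (b : bool) : coin -> bool :=
  fun d => if coin_dec d c then b else w d.

Fixpoint expect (q : coin -> R) (L : list coin) (f : (coin -> bool) -> R) : R :=
  match L with
  | [] => f (fun _ => false)
  | c :: L' =>
      q c * expect q L' (fun w => f (set_coin w c true)) +
      (1 - q c) * expect q L' (fun w => f (set_coin w c false))
  end.

Lemma set_coin_same w c b b' : set_coin (set_coin w c b) c b' = set_coin w c b'.
Proof. extensionality d; unfold set_coin; destruct (coin_dec d c); reflexivity. Qed.

Lemma set_coin_comm w c d b b' :
  c <> d -> set_coin (set_coin w c b) d b' = set_coin (set_coin w d b') c b.
Proof.
intros H; extensionality e; unfold set_coin.
destruct (coin_dec e d), (coin_dec e c); congruence.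
Qed.

Lemma set_coin_eq w c b : set_coin w c b c = b.
Proof. unfold set_coin; destruct (coin_dec c c); congruence. Qed.

Lemma set_coin_neq w c d b : d <> c -> set_coin w c b d = w d.
Proof. intros H; unfold set_coin; destruct (coin_dec d c); congruence. Qed.

Lemma expect_ext q L f g : (forall w, f w = g w) -> expect q L f = expect q L g.
Proof. intros H; f_equal; extensionality w; apply H. Qed.

(** Conditioning on one coin. On the right [c] remains in [L] but its value is overwritten, which
    avoids deleting it from the list. *)
Lemma expect_split q L f c : In c L ->
  expect q L f = q c * expect q L (fun w => f (set_coin w c true)) +
                 (1 - q c) * expect q L (fun w => f (set_coin w c false)).
Proof.
revert f; induction L as [|d L IH]; intros f Hc; [destruct Hc|].
destruct (coin_dec d c) as [->|Hne]; simpl.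
- rewrite !(expect_ext q L (fun w => f (set_coin (set_coin w c _) c _)) _
    (fun w => f_equal f (set_coin_same w c _ _))); ring.
- assert (Hc' : In c L) by (destruct Hc; [congruence|assumption]).
  rewrite (IH (fun w => f (set_coin w d true)) Hc'), (IH (fun w => f (set_coin w d false)) Hc').
  rewrite !(expect_ext q L (fun w => f (set_coin (set_coin w d _) c _)) _
    (fun w => f_equal f (set_coin_comm w d c _ _ Hne))); ring.
Qed.

Lemma expect_plus q L f g : expect q L (fun w => f w + g w) = expect q L f + expect q L g.
Proof.
revert f g; induction L as [|c L IH]; intros f g; simpl; [reflexivity|].
rewrite !IH; ring.
Qed.

Lemma expect_scal q L k f : expect q L (fun w => k * f w) = k * expect q L f.
Proof.
revert f; induction L as [|c L IH]; intros f; simpl; [reflexivity|].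
rewrite !IH; ring.
Qed.

Lemma expect_const q L k : expect q L (fun _ => k) = k.
Proof. induction L as [|c L IH]; simpl; [reflexivity|rewrite IH; ring]. Qed.

(* Outcomes of probability 0 must be discarded: there greedy breaks all ties by index, whatever
   the perturbations. *)
Lemma expect_le q L f g :
  (forall c, In c L -> 0 <= q c <= 1) ->
  (forall w, (forall c, q c = 0 -> w c = false) -> f w <= g w) ->
  expect q L f <= expect q L g.
Proof.
revert f g; induction L as [|c L IH]; intros f g Hq H; simpl; [apply H; reflexivity|].
assert (Hc := Hq c (or_introl eq_refl)).
assert (Hq' : forall d, In d L -> 0 <= q d <= 1) by (intros; apply Hq; right; assumption).
assert (Hf : expect q L (fun w => f (set_coin w c false)) <= expect q L (fun w => g (set_coin w c false))).
{ apply IH; [exact Hq'|]; intros w Hw; apply H; intros d Hd; unfold set_coin.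
  destruct (coin_dec d c); auto. }
apply Rplus_le_compat; [|apply Rmult_le_compat_l; [lra|exact Hf]].
destruct (Req_dec (q c) 0) as [H0|H0]; [rewrite H0; lra|].
apply Rmult_le_compat_l; [lra|].
apply IH; [exact Hq'|]; intros w Hw; apply H; intros d Hd; unfold set_coin.
destruct (coin_dec d c); [congruence|auto].
Qed.

Lemma gavg_expect N n q L (f : (nat -> R) -> (coin -> bool) -> R) :
  gavg N n (fun y => expect q L (f y)) = expect q L (fun w => gavg N n (fun y => f y w)).
Proof.
revert f; induction L as [|c L IH]; intros f; simpl; [reflexivity|].
rewrite gavg_plus, !gavg_scal.
rewrite (IH (fun y w => f y (set_coin w c true))), (IH (fun y w => f y (set_coin w c false))).
reflexivity.
Qed.

(** * Policies driven by coins, and the b-matching along an outcome *)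

Definition legal_offer (n : nat) (a : nat -> option R) (tk : nat -> bool) (o : option nat)
  : option nat :=
  match o with
  | Some i => match a i with
              | Some _ => if (i <? n)%nat && negb (tk i) then Some i else None
              | None => None
              end
  | None => None
  end.

Lemma legal_offer_Some n a tk o i : legal_offer n a tk o = Some i ->
  o = Some i /\ (i < n)%nat /\ a i <> None /\ tk i = false.
Proof.
unfold legal_offer; destruct o as [j|]; [|discriminate].
destruct (a j) eqn:Ha; [|discriminate].
destruct (Nat.ltb_spec j n); simpl; [|discriminate].
destruct (tk j) eqn:Ht; simpl; [discriminate|].
intros [= <-]; repeat split; congruence.
Qed.

Lemma legal_offer_id n a tk i :
  (i < n)%nat -> a i <> None -> tk i = false -> legal_offer n a tk (Some i) = Some i.
Proof.
intros Hi Ha Ht; unfold legal_offer; destruct (a i); [|congruence].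
rewrite (proj2 (Nat.ltb_lt i n) Hi), Ht; reflexivity.
Qed.

Definition incr (m : nat -> nat) (i : nat) : nat -> nat :=
  fun j => if Nat.eqb j i then S (m j) else m j.

(* Reward along a fixed outcome of the coins, where an offer of [i] to an active arrival pays its
   conditional expectation [w i = p_i r_i]; [m i] counts the past offers of [i] to active arrivals. *)
Fixpoint coin_run (pol : OffPolicy) (n : nat) (w : nat -> R) (A : list (nat -> option R))
    (fuel : nat) (h : ohist) (m : nat -> nat) (om : coin -> bool) : R :=
  match fuel with
  | O => 0
  | S f =>
      let (t, o) := pol h in
      if (t <? length A)%nat && negb (processed h t) then
        match legal_offer n (nth t A no_edge) (otaken h) o with
        | Some i =>
            if om (O, t)
            then w i + coin_run pol n w A f (h ++ [(t, Some i, om (S i, m i))]) (incr m i) om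
            else coin_run pol n w A f (h ++ [(t, Some i, false)]) m om
        | None => coin_run pol n w A f (h ++ [(t, None, false)]) m om
        end
      else 0
  end.

Lemma offv_step pol n r A f h : offv pol n r A (S f) h =
  let (t, o) := pol h in
  if (t <? length A)%nat && negb (processed h t) then
    match legal_offer n (nth t A no_edge) (otaken h) o with
    | Some i => match nth t A no_edge i with
       | Some p => p * (r i + offv pol n r A f (h ++ [(t, Some i, true)])) +
                  (1 - p) * offv pol n r A f (h ++ [(t, Some i, false)])
       | None => 0 end
    | None => offv pol n r A f (h ++ [(t, None, false)])
    end
  else 0.
Proof.
simpl; destruct (pol h) as [t o]; destruct ((t <? length A)%nat && negb (processed h t)); [|reflexivity].
unfold legal_offer; destruct o as [i|]; [|reflexivity].
destruct (nth t A no_edge i) eqn:Ha; [|reflexivity].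
destruct ((i <? n)%nat && negb (otaken h i)); [rewrite Ha|]; reflexivity.
Qed.

Lemma processed_app h t o b s :
  processed (h ++ [(t, o, b)]) s = processed h s || Nat.eqb t s.
Proof. unfold processed; rewrite existsb_app; simpl; rewrite orb_false_r; reflexivity. Qed.

Lemma otaken_app h t o b i : otaken (h ++ [(t, o, b)]) i =
  otaken h i || match o with Some j => b && Nat.eqb i j | None => false end.
Proof.
unfold otaken; rewrite existsb_app; simpl; rewrite orb_false_r.
destruct o as [j|], b; reflexivity.
Qed.

Definition used_coin (h : ohist) (m : nat -> nat) (c : coin) : Prop :=
  match c with
  | (O, t) => processed h t = true
  | (S i, k) => (k < m i)%nat
  end.

(** A run reads activity coins only of unprocessed arrivals, and the coins of [i] only from index
    [m i] on. Coins already read are therefore independent of the continuation. *)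
Lemma coin_run_used pol n w A f h m om c b :
  used_coin h m c -> coin_run pol n w A f h m (set_coin om c b) = coin_run pol n w A f h m om.
Proof.
revert h m; induction f as [|f IH]; intros h m Hu; [reflexivity|simpl].
destruct (pol h) as [t o].
destruct (Nat.ltb_spec t (length A)) as [Ht|]; simpl; [|reflexivity].
destruct (processed h t) eqn:Hp; simpl; [reflexivity|].
assert (Hu' : forall o' b' m', (forall i, (m i <= m' i)%nat) -> used_coin (h ++ [(t, o', b')]) m' c).
{ intros o' b' m' Hm; destruct c as [[|i] k]; simpl in *.
  - rewrite processed_app, Hu; reflexivity.
  - specialize (Hm i); lia. }
destruct (legal_offer n (nth t A no_edge) (otaken h) o) as [i|]; [|apply IH, Hu'; auto].
rewrite (set_coin_neq om c (O, t)).
2:{ intros <-; simpl in Hu; congruence. }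
rewrite (set_coin_neq om c (S i, m i)).
2:{ intros <-; simpl in Hu; lia. }
rewrite !IH; try reflexivity; apply Hu'; auto.
intros j; unfold incr; destruct (Nat.eqb j i); lia.
Qed.

Definition coin_prob (pI pT : nat -> R) (c : coin) : R :=
  match c with (O, t) => pT t | (S i, _) => pI i end.

(** Row 0 holds the activity coins and row [S i] those of resource [i]; [T] coins per row suffice,
    since at most [T] arrivals are processed. *)
Definition all_coins (n T : nat) : list coin := list_prod (seq 0 (S n)) (seq 0 T).

Lemma in_all_coins n T s k : In (s, k) (all_coins n T) <-> (s <= n)%nat /\ (k < T)%nat.
Proof. unfold all_coins; rewrite in_prod_iff, !in_seq; lia. Qed.

(** The coupling is faithful: an offer succeeds exactly when two fresh coins come up, which has
    probability [pI i * pT t]. The bound on [m i + f] keeps all coins read within [all_coins]. *)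
Lemma expect_coin_run pol n r A pI pT f h m :
  (forall t i p, (t < length A)%nat -> nth t A no_edge i = Some p -> p = pI i * pT t) ->
  (forall i, (m i + f <= length A)%nat) ->
  expect (coin_prob pI pT) (all_coins n (length A))
    (coin_run pol n (fun i => pI i * r i) A f h m) = offv pol n r A f h.
Proof.
intros Hdec; revert h m; induction f as [|f IH]; intros h m Hm; [exact (expect_const _ _ 0)|].
rewrite offv_step; simpl coin_run.
destruct (pol h) as [t o].
destruct (Nat.ltb_spec t (length A)) as [Ht|]; simpl andb; cbv iota; [|apply expect_const].
destruct (processed h t) eqn:Hp; simpl negb; cbv iota; [apply expect_const|].
assert (Hm0 : forall i, (m i + f <= length A)%nat) by (intros i; specialize (Hm i); lia).
destruct (legal_offer n (nth t A no_edge) (otaken h) o) as [i|] eqn:Hl.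
2:{ rewrite <- (IH _ m Hm0); reflexivity. }
apply legal_offer_Some in Hl; destruct Hl as (_ & Hi & Ha & _).
destruct (nth t A no_edge i) as [p|] eqn:Hp'; [|congruence].
rewrite (Hdec t i p Ht Hp').
assert (Hm1 : forall j, (incr m i j + f <= length A)%nat).
{ intros j; specialize (Hm j); unfold incr; destruct (Nat.eqb j i); lia. }
(* First the activity coin: an inactive [t] rejects the offer and leaves the coins of [i]
   untouched. *)
rewrite (expect_split _ _ _ (O, t)) by (apply in_all_coins; lia).
assert (Hpt : forall o b, processed (h ++ [(t, o, b)]) t = true).
{ intros; rewrite processed_app, Nat.eqb_refl; apply orb_true_r. }
simpl coin_prob.
rewrite (expect_ext _ _ _ (fun om => pI i * r i +
   coin_run pol n (fun i => pI i * r i) A f (h ++ [(t, Some i, om (S i, m i))]) (incr m i) om)).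
2:{ intros om; rewrite set_coin_eq, set_coin_neq, coin_run_used by (discriminate || apply Hpt); reflexivity. }
rewrite (expect_ext _ _ (fun om => if set_coin om (O, t) false (O, t) then _ else _)
  (coin_run pol n (fun i => pI i * r i) A f (h ++ [(t, Some i, false)]) m)).
2:{ intros om; rewrite set_coin_eq, coin_run_used by apply Hpt; reflexivity. }
rewrite IH by exact Hm0.
rewrite expect_plus, expect_const.
(* Given that [t] is active, the next coin of [i] decides; its expected reward [pI i * r i] has been
   paid already. *)
rewrite (expect_split _ _ _ (S i, m i)) by (apply in_all_coins; specialize (Hm i); lia).
simpl coin_prob.
assert (Hb : forall b, expect (coin_prob pI pT) (all_coins n (length A))
   (fun om => coin_run pol n (fun i => pI i * r i) A f
      (h ++ [(t, Some i, set_coin om (S i, m i) b (S i, m i))]) (incr m i) (set_coin om (S i, m i) b))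
   = offv pol n r A f (h ++ [(t, Some i, b)])).
{ intros b; rewrite <- (IH _ (incr m i) Hm1); apply expect_ext; intros om.
  rewrite set_coin_eq, coin_run_used; [reflexivity|].
  simpl; unfold incr; rewrite Nat.eqb_refl; lia. }
rewrite !Hb; ring.
Qed.

Definition wt (w : nat -> R) (o : option nat) : R :=
  match o with Some i => w i | None => 0 end.

Definition eqo (o : option nat) (i : nat) : nat :=
  match o with Some j => if Nat.eqb i j then 1 else 0 | None => 0 end.

Fixpoint cnt (o : nat -> option nat) (T i : nat) : nat :=
  match T with O => O | S t => (cnt o t i + eqo (o t) i)%nat end.

(* Number of offers of a resource to active arrivals that its coins [u] allow. *)
Fixpoint cap (u : nat -> bool) (T : nat) : nat :=
  match T with
  | O => 1
  | S T' => if u O then 1 else S (cap (fun k => u (S k)) T')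
  end%nat.

Lemma lt_cap u T m : (m <= T)%nat -> (forall k, (k < m)%nat -> u k = false) -> (m < cap u T)%nat.
Proof.
revert u m; induction T as [|T IH]; intros u m Hm H; simpl; [lia|].
destruct m as [|m]; [destruct (u O); lia|].
rewrite H by lia; apply -> Nat.succ_lt_mono; apply IH; [lia|]; intros k Hk; apply H; lia.
Qed.

Lemma lt_cap_inv u T m k : (m < cap u T)%nat -> (k < m)%nat -> u k = false.
Proof.
revert u m k; induction T as [|T IH]; intros u m k Hm Hk; simpl in Hm; [lia|].
destruct (u O) eqn:H0; [lia|].
destruct k as [|k]; [exact H0|].
apply (IH (fun k => u (S k)) (pred m)); lia.
Qed.

Lemma cnt_ext o o' T i : (forall t, (t < T)%nat -> o t = o' t) -> cnt o T i = cnt o' T i.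
Proof.
induction T as [|T IH]; intros H; simpl; [reflexivity|].
rewrite IH, H by (intros; try apply H; lia); reflexivity.
Qed.

Definition assign (o : nat -> option nat) (t : nat) (x : option nat) : nat -> option nat :=
  fun s => if Nat.eqb s t then x else o s.

Lemma assign_eq o t x : assign o t x t = x.
Proof. unfold assign; rewrite Nat.eqb_refl; reflexivity. Qed.

Lemma assign_neq o t x s : s <> t -> assign o t x s = o s.
Proof. intros H; unfold assign; destruct (Nat.eqb_spec s t); congruence. Qed.

Lemma cnt_assign o T t i j : (t < T)%nat -> o t = None ->
  cnt (assign o t (Some i)) T j = (cnt o T j + eqo (Some i) j)%nat.
Proof.
induction T as [|T IH]; intros Ht Ho; [lia|]; simpl cnt.
destruct (Nat.eq_dec t T) as [->|Hne].
- rewrite assign_eq, Ho, (cnt_ext (assign o T (Some i)) o); [simpl; lia|].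
  intros s Hs; apply assign_neq; lia.
- rewrite IH, assign_neq by (lia || assumption); lia.
Qed.

Lemma rsum_assign w o T t i : (t < T)%nat -> o t = None ->
  rsum T (fun s => wt w (assign o t (Some i) s)) = w i + rsum T (fun s => wt w (o s)).
Proof.
induction T as [|T IH]; intros Ht Ho; [lia|]; simpl rsum.
destruct (Nat.eq_dec t T) as [->|Hne].
- rewrite assign_eq, Ho, (rsum_ext T _ (fun s => wt w (o s))); [simpl; ring|].
  intros s Hs; rewrite assign_neq by lia; reflexivity.
- rewrite IH, assign_neq by (lia || assumption); ring.
Qed.

Lemma incr_eqo m i j : incr m i j = (m j + eqo (Some i) j)%nat.
Proof. unfold incr; simpl; destruct (Nat.eqb j i); lia. Qed.

(** The map [o] records only the offers to active arrivals. It respects the capacities [cap] because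
    a resource that is still available has seen only [false] coins. *)
Lemma coin_run_path pol n w A om f h m :
  (forall i, (m i + f <= length A)%nat) ->
  (forall i, otaken h i = false -> forall k, (k < m i)%nat -> om (S i, k) = false) ->
  (forall i, (m i <= cap (fun k => om (S i, k)) (length A))%nat) ->
  exists o : nat -> option nat,
    (forall t i, o t = Some i -> (t < length A)%nat /\ processed h t = false /\ (i < n)%nat /\
        nth t A no_edge i <> None /\ om (O, t) = true) /\
    (forall i, (m i + cnt o (length A) i <= cap (fun k => om (S i, k)) (length A))%nat) /\
    coin_run pol n w A f h m om = rsum (length A) (fun t => wt w (o t)).
Proof.
assert (Hnone : forall g T, g = (fun _ => None) ->
   (forall i, cnt g T i = O) /\ rsum T (fun t => wt w (g t)) = 0).
{ intros g T ->; split; [|apply rsum_zero; reflexivity].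
  intros i; induction T as [|T IHT]; simpl; lia. }
destruct (Hnone _ (length A) eq_refl) as (Hn1 & Hn2); clear Hnone.
assert (Hstop : forall h m,
 (forall i, (m i <= cap (fun k => om (S i, k)) (length A))%nat) -> exists o : nat -> option nat,
    (forall t i, o t = Some i -> (t < length A)%nat /\ processed h t = false /\ (i < n)%nat /\
        nth t A no_edge i <> None /\ om (O, t) = true) /\
    (forall i, (m i + cnt o (length A) i <= cap (fun k => om (S i, k)) (length A))%nat) /\
    0 = rsum (length A) (fun t => wt w (o t))).
{ clear h m; intros h m Hc; exists (fun _ => None); split; [discriminate|]; split; [|auto].
  intros i; rewrite Hn1, Nat.add_0_r; apply Hc. }
revert h m; induction f as [|f IH]; intros h m Hm Hinv Hc; [apply Hstop, Hc|].
simpl coin_run.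
destruct (pol h) as [t o].
destruct (Nat.ltb_spec t (length A)) as [Ht|]; simpl andb; cbv iota; [|apply Hstop, Hc].
destruct (processed h t) eqn:Hp; simpl negb; cbv iota; [apply Hstop, Hc|].
assert (Hm0 : forall i, (m i + f <= length A)%nat) by (intros i; specialize (Hm i); lia).
assert (Hskip : forall x, (forall i, otaken (h ++ [(t, x, false)]) i = otaken h i) ->
  exists o : nat -> option nat,
    (forall t i, o t = Some i -> (t < length A)%nat /\ processed h t = false /\ (i < n)%nat /\
        nth t A no_edge i <> None /\ om (O, t) = true) /\
    (forall i, (m i + cnt o (length A) i <= cap (fun k => om (S i, k)) (length A))%nat) /\
    coin_run pol n w A f (h ++ [(t, x, false)]) m om = rsum (length A) (fun t => wt w (o t))).
{ intros x Hx.
  destruct (IH (h ++ [(t, x, false)]) m Hm0) as (o' & Ho1 & Ho2); [|exact Hc|].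
  - intros i Hi; apply Hinv; rewrite <- Hx; exact Hi.
  - exists o'; split; [|exact Ho2]; intros s i Hs; destruct (Ho1 s i Hs) as (H1 & H2 & H3).
    rewrite processed_app in H2; apply orb_false_iff in H2; tauto. }
destruct (legal_offer n (nth t A no_edge) (otaken h) o) as [i|] eqn:Hl.
2:{ apply Hskip; intros i; rewrite otaken_app, orb_false_r; reflexivity. }
apply legal_offer_Some in Hl; destruct Hl as (_ & Hi & Ha & Htk).
destruct (om (O, t)) eqn:Hom.
2:{ apply Hskip; intros j; rewrite otaken_app, orb_false_r; reflexivity. }
destruct (IH (h ++ [(t, Some i, om (S i, m i))]) (incr m i)) as (o' & Ho1 & Ho2 & Ho3).
- intros j; specialize (Hm j); rewrite incr_eqo; simpl; destruct (Nat.eqb j i); lia.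
- intros j; rewrite otaken_app; intros Hj k Hk; apply orb_false_iff in Hj; destruct Hj as (Hj1 & Hj2).
  unfold incr in Hk; destruct (Nat.eqb_spec j i) as [->|Hne]; [|apply Hinv; assumption].
  rewrite andb_true_r in Hj2.
  destruct (Nat.eq_dec k (m i)) as [->|]; [exact Hj2|apply Hinv; [assumption|lia]].
- intros j; specialize (Hc j); unfold incr; destruct (Nat.eqb_spec j i) as [->|Hne]; [|exact Hc].
  apply (lt_cap (fun k => om (S i, k))); [specialize (Hm i); lia|apply Hinv; exact Htk].
(* The continuation regards [t] as processed, so the entry of [t] is free to be set to [i]. *)
- assert (Hot : o' t = None).
  { destruct (o' t) as [j|] eqn:Hj; [|reflexivity].
    destruct (Ho1 t j Hj) as (_ & H & _); rewrite processed_app, Nat.eqb_refl, orb_true_r in H; discriminate. }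
  exists (assign o' t (Some i)); split; [|split].
  + intros s j; destruct (Nat.eq_dec s t) as [->|Hne].
    * rewrite assign_eq; intros [= <-]; auto.
    * rewrite assign_neq by exact Hne; intros Hs; destruct (Ho1 s j Hs) as (H1 & H2 & H3).
      rewrite processed_app in H2; apply orb_false_iff in H2; tauto.
  + intros j; specialize (Ho2 j); rewrite incr_eqo in Ho2; rewrite cnt_assign by assumption; lia.
  + rewrite rsum_assign, Ho3 by assumption; reflexivity.
Qed.

(** * Greedy along a sample path *)

(** Ties go to the smaller index, as in [greedy_choice]. They have to be handled exactly, since
    perturbations on a grid produce ties with positive frequency. *)
Definition beats (w : nat -> R) (i j : nat) : Prop :=
  w j < w i \/ (w j = w i /\ (i < j)%nat).

Definition is_best (av : nat -> Prop) (w : nat -> R) (o : option nat) : Prop :=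
  match o with
  | Some i => av i /\ forall j, av j -> j = i \/ beats w i j
  | None => forall j, ~ av j
  end.

Lemma beats_asym w i j : beats w i j -> beats w j i -> False.
Proof. unfold beats; intros [|[]] [|[]]; try lra; lia. Qed.

Lemma beats_trans w i j k : beats w i j -> beats w j k -> beats w i k.
Proof. unfold beats; intros [|[]] [|[]]; try (left; lra); right; split; [lra|lia]. Qed.

Lemma beats_total w i j : i <> j -> beats w i j \/ beats w j i.
Proof.
unfold beats; intros H.
destruct (Rtotal_order (w i) (w j)) as [|[|]]; [tauto| |tauto].
destruct (proj1 (Nat.lt_gt_cases i j) H); [left|right]; right; split; auto.
Qed.

Lemma beats_le w i j : beats w i j -> w j <= w i.
Proof. unfold beats; intros [|[]]; lra. Qed.

Lemma is_best_unique av w o o' : is_best av w o -> is_best av w o' -> o = o'.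
Proof.
destruct o as [i|], o' as [j|]; simpl.
- intros (Hi & Hi') (Hj & Hj').
  destruct (Hi' j Hj) as [->|B1]; [reflexivity|].
  destruct (Hj' i Hi) as [->|B2]; [reflexivity|].
  destruct (beats_asym _ _ _ B1 B2).
- intros (Hi & _) H; destruct (H i Hi).
- intros H (Hi & _); destruct (H j Hi).
- reflexivity.
Qed.

(** Serves both for rewriting the set of available resources and for changing the weights, whose
    orders need to agree on that set only. *)
Lemma is_best_transport (av av' : nat -> Prop) w w' o :
  (forall i, av i <-> av' i) ->
  (forall i j, av i -> av j -> beats w i j -> beats w' i j) ->
  is_best av w o -> is_best av' w' o.
Proof.
intros Hav Hb; destruct o as [i|]; simpl.
- intros (Hi & H); split; [apply Hav, Hi|]; intros j Hj.
  destruct (H j (proj2 (Hav j) Hj)); [auto|right; apply Hb; auto; apply Hav, Hj].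
- intros H j Hj; apply (H j), Hav, Hj.
Qed.

Lemma is_best_exists n (av : nat -> Prop) w :
  (forall j, av j -> (j < n)%nat) -> exists o, is_best av w o.
Proof.
revert av; induction n as [|n IH]; intros av Hn.
- exists None; intros j Hj; specialize (Hn j Hj); lia.
- destruct (IH (fun j => av j /\ (j < n)%nat)) as (o & Ho); [tauto|].
  assert (Hs : forall j, av j -> j <> n -> av j /\ (j < n)%nat).
  { intros j Hj Hne; specialize (Hn j Hj); split; [exact Hj|lia]. }
  destruct (classic (av n)) as [Hav|Hav].
  + destruct o as [i|]; simpl in Ho.
    * destruct Ho as ((Hi & Hin) & Ho).
      destruct (beats_total w i n ltac:(lia)) as [B|B].
      -- exists (Some i); split; [exact Hi|]; intros j Hj.
         destruct (Nat.eq_dec j n) as [->|Hne]; auto.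
      -- exists (Some n); split; [exact Hav|]; intros j Hj.
         destruct (Nat.eq_dec j n) as [->|Hne]; [auto|right].
         destruct (Ho j (Hs j Hj Hne)) as [->|B']; [exact B|eapply beats_trans; eauto].
    * exists (Some n); split; [exact Hav|]; intros j Hj.
      destruct (Nat.eq_dec j n) as [->|Hne]; [auto|destruct (Ho j (Hs j Hj Hne))].
  + exists o; revert Ho; apply is_best_transport; [|auto].
    intros j; split; [tauto|]; intros Hj; apply Hs; [exact Hj|intros ->; tauto].
Qed.

Definition edge_wt (a : nat -> option R) (r y : nat -> R) (j : nat) : R :=
  match a j with Some p => p * r j * (1 - gfun (y j)) | None => 0 end.

(** The fold scans increasing indices and replaces the incumbent only by a strictly larger weight,
    so ties keep the smaller index. The induction also tracks that the stored number is the weight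
    of the incumbent. *)
Lemma greedy_choice_best n r y a h :
  is_best (fun j => (j < n)%nat /\ a j <> None /\ taken h j = false)
    (edge_wt a r y) (greedy_choice n r y a h).
Proof.
unfold greedy_choice.
set (step := fun (best : option (nat * R)) (i : nat) => _).
assert (H : is_best (fun j => (j < n)%nat /\ a j <> None /\ taken h j = false)
    (edge_wt a r y) (option_map fst (fold_left step (seq 0 n) None)) /\
   forall i b, fold_left step (seq 0 n) None = Some (i, b) -> b = edge_wt a r y i).
2:{ apply H. }
induction n as [|n [IH1 IH2]].
{ split; [simpl; intros j Hj; lia|discriminate]. }
rewrite seq_S, fold_left_app; simpl fold_left.
set (best := fold_left step (seq 0 n) None) in *.
unfold step.
destruct (a n) as [p|] eqn:Ha.
2:{ split; [|exact IH2].
    revert IH1; apply is_best_transport; [|auto].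
    intros j; split; [intros (H1 & H2 & H3); repeat split; auto; lia|].
    intros (H1 & H2 & H3); repeat split; auto.
    destruct (Nat.eq_dec j n) as [->|]; [congruence|lia]. }
destruct (taken h n) eqn:Ht.
{ split; [|exact IH2].
    revert IH1; apply is_best_transport; [|auto].
    intros j; split; [intros (H1 & H2 & H3); repeat split; auto; lia|].
    intros (H1 & H2 & H3); repeat split; auto.
    destruct (Nat.eq_dec j n) as [->|]; [congruence|lia]. }
assert (Hw : p * r n * (1 - gfun (y n)) = edge_wt a r y n) by (unfold edge_wt; rewrite Ha; reflexivity).
assert (Hn : (n < S n)%nat /\ a n <> None /\ taken h n = false) by (repeat split; [lia|congruence|exact Ht]).
destruct best as [[i b]|] eqn:Hbest; simpl option_map in IH1.
- specialize (IH2 i b eq_refl); simpl in IH1; destruct IH1 as ((Hi & Hi') & IH1).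
  rewrite Hw, IH2; destruct (Rlt_dec (edge_wt a r y i) (edge_wt a r y n)) as [Hlt|Hge]; simpl.
  + split; [split; [exact Hn|]|intros ? ? [= <- <-]; reflexivity].
    intros j (Hj & Hj'); destruct (Nat.eq_dec j n) as [->|Hne]; [auto|right].
    destruct (IH1 j ltac:(split; [lia|exact Hj'])) as [->|B]; [left; exact Hlt|].
    apply beats_trans with i; [left; exact Hlt|exact B].
  + split; [split; [split; [lia|exact Hi']|]|intros ? ? [= <- <-]; reflexivity].
    intros j (Hj & Hj'); destruct (Nat.eq_dec j n) as [->|Hne].
    * right; unfold beats; destruct (Rle_lt_or_eq_dec _ _ (Rnot_lt_le _ _ Hge)); [left; assumption|].
      right; split; [assumption|lia].
    * apply IH1; split; [lia|exact Hj'].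
- split; [|intros ? ? [= <- <-]; exact Hw].
  simpl in *; split; [exact Hn|]; intros j (Hj & Hj').
  destruct (Nat.eq_dec j n) as [->|Hne]; [auto|].
  destruct (IH1 j); split; [lia|exact Hj'].
Qed.

(** A predicate and not a function, because the runs to be compared have different origins: one is
    read off a [coin_run], the other comes from an existence lemma. *)
Definition greedy_run (n T : nat) (adj : nat -> nat -> Prop) (c : nat -> nat)
    (w : nat -> R) (P : nat -> option nat) : Prop :=
  forall t, (t < T)%nat ->
    is_best (fun j => (j < n)%nat /\ adj t j /\ (cnt P t j < c j)%nat) w (P t).

Lemma greedy_run_exists n T adj c w : exists P, greedy_run n T adj c w P.
Proof.
induction T as [|T (P & HP)]; [exists (fun _ => None); intros t Ht; lia|].
destruct (is_best_exists n (fun j => (j < n)%nat /\ adj T j /\ (cnt P T j < c j)%nat) w) as (o & Ho);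
  [tauto|].
assert (Hc : forall t j, (t <= T)%nat -> cnt (assign P T o) t j = cnt P t j).
{ intros t j Ht; apply cnt_ext; intros s Hs; apply assign_neq; lia. }
exists (assign P T o); intros t Ht.
destruct (Nat.eq_dec t T) as [->|Hne].
- rewrite assign_eq; revert Ho; apply is_best_transport; [|auto].
  intros j; rewrite Hc by lia; reflexivity.
- rewrite assign_neq by exact Hne; generalize (HP t ltac:(lia)); apply is_best_transport; [|auto].
  intros j; rewrite Hc by lia; reflexivity.
Qed.

(* Comparison of the greedy runs without ([P1]) and with ([P2]) resource [i]: the copies that
   [P2] has in excess all belong to resources beaten by [i]. *)
Lemma greedy_run_insert n T adj c i w P1 P2 :
  greedy_run n T (fun t j => adj t j /\ j <> i) c w P1 ->
  greedy_run n T adj c w P2 ->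
  forall t, (t <= T)%nat -> forall j, j <> i ->
    (cnt P2 t j <= cnt P1 t j)%nat /\ ((cnt P2 t j < cnt P1 t j)%nat -> beats w i j).
Proof.
intros H1 H2; induction t as [|t IH]; intros Ht j Hj; [simpl; lia|].
specialize (IH ltac:(lia)).
specialize (H1 t ltac:(lia)); specialize (H2 t ltac:(lia)).
assert (Hav : forall k, (k < n)%nat /\ (adj t k /\ k <> i) /\ (cnt P1 t k < c k)%nat ->
   (k < n)%nat /\ adj t k /\ (cnt P2 t k < c k)%nat).
{ intros k (A1 & (A2 & A3) & A4); destruct (IH k A3); repeat split; auto; lia. }
assert (Hex : forall k, k <> i -> (k < n)%nat /\ adj t k /\ (cnt P2 t k < c k)%nat ->
   ~ (cnt P1 t k < c k)%nat -> (cnt P2 t k < cnt P1 t k)%nat).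
{ intros k _ (_ & _ & A) B; lia. }
destruct (IH j Hj) as (IHj & IHb).
simpl cnt.
destruct (P2 t) as [j2|] eqn:E2; simpl in H2.
2:{ destruct (P1 t) as [j1|] eqn:E1; simpl in H1; [|simpl; rewrite !Nat.add_0_r; auto].
    destruct (H2 j1 (Hav j1 (proj1 H1))). }
destruct H2 as (A2 & B2).
destruct (Nat.eq_dec j2 i) as [->|Hj2].
(* If [P2] picks [i], then [i] beats the choice of [P1], which is available to [P2] as well. *)
- simpl eqo at 1 3; destruct (Nat.eqb_spec j i) as [|_]; [congruence|rewrite Nat.add_0_r].
  split; [lia|]; intros Hlt.
  destruct (P1 t) as [j1|] eqn:E1; simpl in Hlt, H1; [|apply IHb; lia].
  destruct (Nat.eqb_spec j j1) as [->|]; [|apply IHb; lia].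
  destruct (B2 j1 (Hav j1 (proj1 H1))); [congruence|assumption].
(* If [j2] is available to [P1] too, both runs pick the same resource. *)
- destruct (classic (cnt P1 t j2 < c j2)%nat) as [Hc|Hc].
  + assert (Av : (j2 < n)%nat /\ (adj t j2 /\ j2 <> i) /\ (cnt P1 t j2 < c j2)%nat) by tauto.
    destruct (P1 t) as [j1|] eqn:E1; simpl in H1; [|destruct (H1 j2 Av)].
    destruct H1 as (A1 & B1).
    destruct (B1 j2 Av) as [->|C1]; [split; [lia|intros; apply IHb; lia]|].
    destruct (B2 j1 (Hav j1 A1)) as [->|C2]; [split; [lia|intros; apply IHb; lia]|].
    destruct (beats_asym _ _ _ C1 C2).
  (* Here [j2] is exhausted in [P1] but not in [P2]. By induction [i] beats [j2], and [j2] beats any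
     other choice of [P1]. *)
  + assert (Hlt2 := Hex j2 Hj2 A2 Hc).
    assert (Bi := proj2 (IH j2 Hj2) Hlt2).
    assert (Hi1 : P1 t = Some j -> beats w i j).
    { intros E1; rewrite E1 in H1; destruct H1 as (A1 & _).
      destruct (B2 j (Hav j A1)) as [->|C2]; [exact Bi|eapply beats_trans; eauto]. }
    split.
    * simpl; destruct (Nat.eqb_spec j j2) as [->|]; lia.
    * intros Hlt; destruct (P1 t) as [j1|]; simpl in Hlt.
      -- destruct (Nat.eqb_spec j j1) as [->|]; [apply Hi1; reflexivity|apply IHb; lia].
      -- apply IHb; lia.
Qed.

(** By [greedy_run_insert] the choice of [P1] is still available to [P2]. Thus the critical bid in
    the run without [i] bounds the dual value of [t] from below. *)
Lemma greedy_run_value_mono n T adj c i w P1 P2 :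
  (forall j, 0 <= w j) ->
  greedy_run n T (fun t j => adj t j /\ j <> i) c w P1 ->
  greedy_run n T adj c w P2 ->
  forall t, (t < T)%nat -> wt w (P1 t) <= wt w (P2 t).
Proof.
intros Hw H1 H2 t Ht.
assert (Hins := greedy_run_insert _ _ _ _ _ _ _ _ H1 H2 t ltac:(lia)).
specialize (H1 t Ht); specialize (H2 t Ht).
destruct (P1 t) as [j1|]; simpl in *; [|destruct (P2 t); simpl; [apply Hw|lra]].
destruct H1 as ((A1 & (A2 & A3) & A4) & _).
assert (Av : (j1 < n)%nat /\ adj t j1 /\ (cnt P2 t j1 < c j1)%nat).
{ destruct (Hins j1 A3); repeat split; auto; lia. }
destruct (P2 t) as [j2|]; simpl in *; [|destruct (H2 j1 Av)].
destruct (proj2 H2 j1 Av) as [->|B]; [lra|apply beats_le, B].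
Qed.

(** Suppose [P2] prefers some [j2] to [i]. If [j2] is available to [P1], then [P1] gets at least the
    weight of [i]; otherwise [P2] has a copy of [j2] in excess, so [i] beats [j2]. Both are
    contradictions. *)
Lemma greedy_run_offers n T adj c i w P1 P2 : (i < n)%nat ->
  greedy_run n T (fun t j => adj t j /\ j <> i) c w P1 ->
  greedy_run n T adj c w P2 ->
  forall t, (t < T)%nat -> adj t i -> wt w (P1 t) < w i -> (cnt P2 t i < c i)%nat -> P2 t = Some i.
Proof.
intros Hi H1 H2 t Ht Hadj Hlt Hci.
assert (Hins := greedy_run_insert _ _ _ _ _ _ _ _ H1 H2 t ltac:(lia)).
specialize (H1 t Ht); specialize (H2 t Ht).
assert (Avi : (i < n)%nat /\ adj t i /\ (cnt P2 t i < c i)%nat) by auto.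
destruct (P2 t) as [j2|]; simpl in H2; [|destruct (H2 i Avi)].
destruct H2 as (A2 & B2).
destruct (B2 i Avi) as [->|B]; [reflexivity|exfalso].
destruct (Nat.eq_dec j2 i) as [->|Hne]; [exact (beats_asym _ _ _ B B)|].
destruct (classic (cnt P1 t j2 < c j2)%nat) as [Hc|Hc].
- assert (Av : (j2 < n)%nat /\ (adj t j2 /\ j2 <> i) /\ (cnt P1 t j2 < c j2)%nat) by tauto.
  destruct (P1 t) as [j1|]; simpl in H1, Hlt; [|destruct (H1 j2 Av)].
  apply beats_le in B; destruct (proj2 H1 j2 Av) as [->|B1]; [lra|apply beats_le in B1; lra].
- apply (beats_asym w i j2); [|exact B].
  apply Hins; [exact Hne|]; lia.
Qed.

Definition ind (P : Prop) : R := if excluded_middle_informative P then 1 else 0.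

Lemma ind_true (P : Prop) : P -> ind P = 1.
Proof. unfold ind; destruct excluded_middle_informative; tauto. Qed.

Lemma ind_false (P : Prop) : ~ P -> ind P = 0.
Proof. unfold ind; destruct excluded_middle_informative; tauto. Qed.

Lemma ind_ge0 (P : Prop) : 0 <= ind P.
Proof. unfold ind; destruct excluded_middle_informative; lra. Qed.

Lemma INR_eqo o i : INR (eqo o i) = ind (o = Some i).
Proof.
destruct o as [j|]; simpl; [|rewrite ind_false; [reflexivity|discriminate]].
destruct (Nat.eqb_spec i j) as [->|H]; simpl; [rewrite ind_true; reflexivity|].
rewrite ind_false; [reflexivity|congruence].
Qed.

Lemma INR_cnt o T i : INR (cnt o T i) = rsum T (fun t => ind (o t = Some i)).
Proof. induction T as [|T IH]; simpl; [reflexivity|rewrite plus_INR, IH, INR_eqo; reflexivity]. Qed.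

Lemma rsum_ind_option n (f : nat -> R) o : (forall i, o = Some i -> (i < n)%nat) ->
  rsum n (fun i => f i * ind (o = Some i)) = wt f o.
Proof.
intros Ho; destruct o as [j|]; simpl.
- specialize (Ho j eq_refl); induction n as [|n IH]; [lia|simpl].
  destruct (Nat.eq_dec j n) as [->|Hne].
  + rewrite rsum_zero, ind_true; [ring|reflexivity|].
    intros k Hk; rewrite ind_false; [ring|injection; lia].
  + rewrite IH, ind_false; [ring|congruence|lia].
- apply rsum_zero; intros k _; rewrite ind_false; [ring|discriminate].
Qed.

Lemma rsum_wt_cnt n f o T : (forall t i, (t < T)%nat -> o t = Some i -> (i < n)%nat) ->
  rsum T (fun t => wt f (o t)) = rsum n (fun i => f i * INR (cnt o T i)).
Proof.
intros Ho.
rewrite (rsum_ext T _ (fun t => rsum n (fun i => f i * ind (o t = Some i)))).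
2:{ intros t Ht; rewrite rsum_ind_option; [reflexivity|eauto]. }
rewrite rsum_swap; apply rsum_ext; intros i _; rewrite INR_cnt, rsum_scal; reflexivity.
Qed.

(* [o] offers [i] at most [c i] times, so resource [i] is exhausted by greedy or serves
   all the arrivals of [o] at which it outbids the run without it. *)
Lemma greedy_run_cnt_ge n T adj c i w P1 P2 (o : nat -> option nat) : (i < n)%nat ->
  greedy_run n T (fun t j => adj t j /\ j <> i) c w P1 ->
  greedy_run n T adj c w P2 ->
  (forall t, (t < T)%nat -> o t = Some i -> adj t i) -> (cnt o T i <= c i)%nat ->
  rsum T (fun t => ind (o t = Some i) * ind (wt w (P1 t) < w i)) <= INR (cnt P2 T i).
Proof.
intros Hi H1 H2 Ho Hc.
(* Until [i] is exhausted, each arrival counted on the left receives [i] both in [o] and in [P2]. *)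
assert (H : forall t, (t <= T)%nat -> rsum t (fun t => ind (o t = Some i) * ind (wt w (P1 t) < w i))
   <= INR (Nat.min (cnt o t i) (cnt P2 t i)) \/ (c i <= cnt P2 t i)%nat).
{ induction t as [|t IH]; intros Ht; [left; simpl; lra|].
  destruct (IH ltac:(lia)) as [IH'|IH']; [|right; simpl; lia].
  destruct (le_lt_dec (c i) (cnt P2 t i)) as [|Hlt]; [right; simpl; lia|left].
  simpl rsum; simpl cnt.
  destruct (classic (o t = Some i)) as [E|E].
  - destruct (classic (wt w (P1 t) < w i)) as [L|L].
    + assert (E2 : P2 t = Some i) by (eapply greedy_run_offers; eauto).
      rewrite !ind_true by assumption; rewrite E, E2; simpl eqo; rewrite Nat.eqb_refl.
      rewrite Nat.add_min_distr_r, plus_INR; simpl; lra.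
    + rewrite (ind_false _ L), Rmult_0_r, Rplus_0_r.
      eapply Rle_trans; [exact IH'|apply le_INR; lia].
  - rewrite (ind_false _ E), Rmult_0_l, Rplus_0_r.
      eapply Rle_trans; [exact IH'|apply le_INR; lia]. }
destruct (H T (le_n T)) as [H'|H'].
- eapply Rle_trans; [exact H'|apply le_INR; lia].
(* If [i] is exhausted, [P2] has used its whole capacity, which [o] cannot exceed. *)
- apply Rle_trans with (INR (cnt o T i)); [|apply le_INR; lia].
  rewrite INR_cnt; apply rsum_le; intros t _.
  assert (A := ind_ge0 (o t = Some i)).
  destruct (classic (wt w (P1 t) < w i)) as [L|L];
    [rewrite (ind_true _ L)|rewrite (ind_false _ L)]; lra.
Qed.

(** * Estimates for the trade-off function [g] *)

Lemma exp_m1_bounds : 0 < exp (-1) < 1.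
Proof. split; [apply exp_pos|]; rewrite <- exp_0; apply exp_increasing; lra. Qed.

Lemma gfun_incr x y : x <= y -> gfun x <= gfun y.
Proof.
intros [H| ->]; [|lra]; left; apply exp_increasing; lra.
Qed.

Lemma gfun_01 x : 0 <= x <= 1 -> exp (-1) <= gfun x <= 1.
Proof.
intros Hx.
assert (E0 : gfun 0 = exp (-1)) by (unfold gfun; f_equal; ring).
assert (E1 : gfun 1 = 1) by (unfold gfun; rewrite <- exp_0; f_equal; ring).
assert (H0 := gfun_incr 0 x ltac:(lra)); assert (H1 := gfun_incr x 1 ltac:(lra)); lra.
Qed.

(** As [g' = g] and [g] is convex, its graph lies above the tangent at the right end; hence
    right-endpoint sums of [g] dominate its increments. *)
Lemma gfun_step x d : gfun (x + d) - gfun x <= gfun (x + d) * d.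
Proof.
unfold gfun; replace (x - 1) with (x + d - 1 + - d) by ring.
rewrite (exp_plus (x + d - 1)).
assert (H := exp_ineq1_le (- d)); assert (Hp := exp_pos (x + d - 1)); nra.
Qed.

(* Riemann sum for [int_0^Y g = g(Y) - 1/e], where [w (1 - g(Y)) = z]. *)
Lemma gfun_threshold_sum N w z : (0 < N)%nat -> 0 <= w -> 0 <= z ->
  (1 - exp (-1) - / INR N) * w <=
  rsum N (fun k => z + w * gfun (gridpt N (S k)) * ind (z < w * (1 - gfun (gridpt N (S k))))) / INR N.
Proof.
intros HN Hw Hz; assert (HNp := inv_INR_pos N HN); assert (He := exp_m1_bounds).
rewrite rsum_plus, rsum_const.
set (s := fun k => w * gfun (gridpt N (S k)) * ind (z < w * (1 - gfun (gridpt N (S k))))).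
(* Left: the first [M] grid points lie below the threshold. Right: the threshold has been passed,
   and the cell containing it costs [w / INR N]. *)
assert (H : forall M, (M <= N)%nat ->
  w * (gfun (gridpt N M) - exp (-1)) <= rsum M s / INR N \/
  w - z - w * exp (-1) - w / INR N <= rsum M s / INR N).
{ induction M as [|M IH]; intros HM.
  - left; rewrite gridpt_0; unfold gfun; replace (0 - 1) with (-1) by ring; simpl; unfold Rdiv; lra.
  - assert (Hg := gfun_01 (gridpt N (S M)) (gridpt_range N (S M) HN HM)).
    assert (Hst := gfun_step (gridpt N M) (/ INR N)); rewrite <- gridpt_S in Hst by exact HN.
    simpl rsum.
    assert (Hs : 0 <= s M).
    { unfold s; apply Rmult_le_pos; [apply Rmult_le_pos; lra|apply ind_ge0]. }
    unfold Rdiv in *; rewrite Rmult_plus_distr_r.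
    assert (0 <= s M * / INR N) by (apply Rmult_le_pos; lra).
    destruct (IH ltac:(lia)) as [IH'|IH']; [|right; lra].
    destruct (classic (z < w * (1 - gfun (gridpt N (S M))))) as [L|L].
    + left; unfold s at 2; rewrite (ind_true _ L), Rmult_1_r.
      assert (w * (gfun (gridpt N (S M)) - gfun (gridpt N M)) <= w * (gfun (gridpt N (S M)) * / INR N))
        by (apply Rmult_le_compat_l; lra).
      lra.
    + right; apply Rnot_lt_le in L.
      assert (w * (gfun (gridpt N (S M)) - gfun (gridpt N M)) <= w * / INR N).
      { apply Rmult_le_compat_l; [lra|].
        assert (gfun (gridpt N (S M)) * / INR N <= 1 * / INR N) by (apply Rmult_le_compat_r; lra).
        lra. }
      lra. }
replace ((INR N * z + rsum N s) / INR N) with (z + rsum N s / INR N)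
  by (field; apply not_0_INR; lia).
replace (1 - exp (-1) - / INR N) with (1 - exp (-1) + - / INR N) by ring.
unfold Rdiv in *.
destruct (H N (le_n N)) as [H'|H'].
- rewrite gridpt_N in H' by exact HN; unfold gfun in H'; replace (1 - 1) with 0 in H' by ring.
  rewrite exp_0 in H'. assert (0 <= w * / INR N) by (apply Rmult_le_pos; lra). lra.
- lra.
Qed.

Definition prio (w y : nat -> R) (j : nat) : R := w j * (1 - gfun (y j)).

Lemma upd_same y i x : upd y i x i = x.
Proof. unfold upd; rewrite Nat.eqb_refl; reflexivity. Qed.

Lemma prio_upd_neq w y i x j : j <> i -> prio w (upd y i x) j = prio w y j.
Proof. intros H; unfold prio, upd; destruct (Nat.eqb_spec j i); congruence. Qed.

(* The primal-dual argument along a fixed outcome of the coins. *)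
Lemma greedy_run_competitive N n T adj c w (P : (nat -> R) -> nat -> option nat) (o : nat -> option nat) :
  (0 < N)%nat -> (forall j, 0 <= w j) ->
  (forall y, greedy_run n T adj c (prio w y) (P y)) ->
  (forall t i, (t < T)%nat -> o t = Some i -> (i < n)%nat /\ adj t i) ->
  (forall i, (cnt o T i <= c i)%nat) ->
  (1 - exp (-1) - / INR N) * rsum T (fun t => wt w (o t)) <=
  gavg N n (fun y => rsum T (fun t => wt w (P y t))).
Proof.
intros HN Hw HP Ho Hcap; assert (HNp := inv_INR_pos N HN).
assert (Hprio : forall y j, in_cube y -> 0 <= prio w y j).
{ intros y j Hy; assert (H := gfun_01 _ (Hy j)); unfold prio; apply Rmult_le_pos; [apply Hw|lra]. }
assert (HPn : forall y t i, (t < T)%nat -> P y t = Some i -> (i < n)%nat).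
{ intros y t i Ht E; specialize (HP y t Ht); rewrite E in HP; apply HP. }
(* The dual share of [i] together with the shares of the arrivals that [o] assigns to [i]. *)
pose (F := fun i y => w i * gfun (y i) * INR (cnt (P y) T i) +
    rsum T (fun t => ind (o t = Some i) * wt (prio w y) (P y t))).
apply Rle_trans with (gavg N n (fun y => rsum n (fun i => F i y))).
(* No share is counted twice, because [o] assigns an arrival to at most one resource. *)
2:{ apply gavg_le; [exact HN|]; intros y Hy; unfold F; rewrite rsum_plus.
    rewrite (rsum_ext T (fun t => wt w (P y t))
      (fun t => wt (fun i => w i * gfun (y i)) (P y t) + wt (prio w y) (P y t))).
    2:{ intros t _; destruct (P y t); unfold prio; simpl; ring. }
    rewrite rsum_plus.
    rewrite (rsum_wt_cnt n (fun i => w i * gfun (y i))) by (intros t i; apply HPn).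
    apply Rplus_le_compat_l; rewrite rsum_swap; apply rsum_le; intros t Ht.
    assert (Hv : 0 <= wt (prio w y) (P y t)) by (destruct (P y t); simpl; [apply Hprio, Hy|lra]).
    rewrite (rsum_ext n _ (fun i => wt (prio w y) (P y t) * ind (o t = Some i))) by (intros; ring).
    rewrite rsum_ind_option; [|intros i E; apply (Ho t i Ht E)].
    destruct (o t); simpl; lra. }
rewrite gavg_rsum by exact HN.
rewrite (rsum_wt_cnt n w o) by (intros t i Ht E; apply (Ho t i Ht E)).
rewrite <- rsum_scal; apply rsum_le; intros i Hi.
apply gavg_coord_ge with i; [exact HN|exact Hi|]; intros y Hy.
(* All perturbations but that of [i] are fixed. The run [P1] without [i] does not see [y i], so the
   critical bids [z t] are constants. *)
destruct (greedy_run_exists n T (fun t j => adj t j /\ j <> i) c (prio w y)) as (P1 & HP1).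
assert (HP1' : forall x, greedy_run n T (fun t j => adj t j /\ j <> i) c (prio w (upd y i x)) P1).
{ intros x t Ht; generalize (HP1 t Ht); apply is_best_transport; [tauto|].
  intros j k Hj Hk; unfold beats; rewrite !prio_upd_neq by tauto; tauto. }
assert (Hz : forall x t, (t < T)%nat -> wt (prio w (upd y i x)) (P1 t) = wt (prio w y) (P1 t)).
{ intros x t Ht; specialize (HP1 t Ht); destruct (P1 t) as [j|]; simpl in *; [|reflexivity].
  apply prio_upd_neq; tauto. }
assert (Hz0 : forall t, 0 <= wt (prio w y) (P1 t)).
{ intros t; destruct (P1 t); simpl; [apply Hprio, Hy|lra]. }
set (z := fun t => wt (prio w y) (P1 t)) in *.
(* Each arrival that [o] gives to [i] is credited with [z t], and with [w i * gfun (y i)] if the bid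
   of [i] exceeds [z t]; [gfun_threshold_sum] averages this over the grid. *)
apply Rle_trans with (rsum N (fun k => rsum T (fun t => ind (o t = Some i) *
   (z t + w i * gfun (gridpt N (S k)) * ind (z t < w i * (1 - gfun (gridpt N (S k))))))) / INR N).
- rewrite rsum_swap.
  apply Rle_trans with (rsum T (fun t => (1 - exp (-1) - / INR N) * w i * ind (o t = Some i))).
  { rewrite rsum_scal, INR_cnt; right; ring. }
  unfold Rdiv; rewrite Rmult_comm with (r2 := / INR N), <- rsum_scal.
  apply rsum_le; intros t _; rewrite rsum_scal.
  assert (G := gfun_threshold_sum N (w i) (z t) HN (Hw i) (Hz0 t)); unfold Rdiv in G.
  apply (Rmult_le_compat_l (ind (o t = Some i))) in G; [|apply ind_ge0].
  lra.
- apply Rmult_le_compat_r; [lra|]; apply rsum_le; intros k Hk; unfold F; cbv beta.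
  set (x := gridpt N (S k)); set (y' := upd y i x).
  assert (Hx : 0 <= x <= 1) by (apply gridpt_range; lia).
  assert (Hy' : in_cube y') by (apply upd_cube; assumption).
  assert (Hyi : y' i = x) by apply upd_same; rewrite Hyi.
  rewrite (rsum_ext T _ (fun t => w i * gfun x * (ind (o t = Some i) * ind (z t < w i * (1 - gfun x)))
     + ind (o t = Some i) * z t)) by (intros; ring).
  rewrite rsum_plus, rsum_scal; apply Rplus_le_compat.
  + apply Rmult_le_compat_l.
    { assert (H := gfun_01 x Hx); assert (He := exp_m1_bounds); apply Rmult_le_pos; [apply Hw|lra]. }
    eapply Rle_trans; [|apply (greedy_run_cnt_ge n T adj c i (prio w y') P1 (P y') o); auto].
    2:{ apply HP1'. }
    2:{ intros t Ht E; apply (Ho t i Ht E). }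
    right; apply rsum_ext; intros t Ht.
    unfold y' at 1; rewrite Hz by exact Ht; unfold prio; rewrite Hyi; reflexivity.
  + apply rsum_le; intros t Ht; apply Rmult_le_compat_l; [apply ind_ge0|].
    unfold z; rewrite <- (Hz x t Ht).
    apply (greedy_run_value_mono n T adj c i (prio w y') P1 (P y')); auto.
    apply HP1'.
Qed.

(** * Competitiveness of perturbed greedy *)

Definition strip (x : nat * option nat * bool) : option nat * bool :=
  match x with (_, o, b) => (o, b) end.

(** Embeds clairvoyant policies into fully offline ones: the next arrival is the number of those
    processed. One benchmark then covers both. *)
Definition in_order_policy (pol : ClairPolicy) : OffPolicy :=
  fun h => (length h, pol (map strip h)).

Definition in_order (h : ohist) : Prop := map (fun x => fst (fst x)) h = seq 0 (length h).

Lemma taken_strip h i : taken (map strip h) i = otaken h i.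
Proof.
unfold taken, otaken; induction h as [|[[t o] b] h IH]; [reflexivity|simpl].
rewrite IH; destruct o as [j|], b; reflexivity.
Qed.

Lemma in_order_app h o b : in_order h -> in_order (h ++ [(length h, o, b)]).
Proof.
unfold in_order; intros H; rewrite map_app, H, length_app, seq_app; reflexivity.
Qed.

Lemma processed_in_order h t : in_order h -> processed h t = (t <? length h)%nat.
Proof.
unfold in_order, processed; intros H.
apply eq_true_iff_eq; rewrite existsb_exists, Nat.ltb_lt.
assert (E : In t (map (fun x => fst (fst x)) h) <-> (t < length h)%nat) by (rewrite H, in_seq; lia).
rewrite <- E, in_map_iff; split.
- intros ([[s o] b] & Hin & Hs); apply Nat.eqb_eq in Hs; exists (s, o, b); auto.
- intros ([[s o] b] & Hs & Hin); exists (s, o, b); split; [exact Hin|apply Nat.eqb_eq; exact Hs].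
Qed.

Lemma skipn_nth {X : Type} (d : X) k l :
  (k < length l)%nat -> skipn k l = nth k l d :: skipn (S k) l.
Proof.
revert k; induction l as [|x l IH]; intros k Hk; [simpl in Hk; lia|].
destruct k as [|k]; [reflexivity|simpl in *; apply IH; lia].
Qed.

Lemma offv_in_order pol n r A f h : in_order h -> (f + length h = length A)%nat ->
  offv (in_order_policy pol) n r A f h = cv pol n r (skipn (length h) A) (map strip h).
Proof.
revert h; induction f as [|f IH]; intros h Hh Hf.
- rewrite skipn_all2 by lia; reflexivity.
- rewrite (skipn_nth no_edge) by lia; simpl.
  rewrite (proj2 (Nat.ltb_lt _ _)) by lia.
  rewrite processed_in_order, Nat.ltb_irrefl by exact Hh; simpl.
  assert (Hrec : forall o b, offv (in_order_policy pol) n r A f (h ++ [(length h, o, b)]) =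
     cv pol n r (skipn (S (length h)) A) (map strip h ++ [(o, b)])).
  { intros o b; rewrite IH; [|apply in_order_app, Hh|rewrite length_app; simpl; lia].
    rewrite length_app, map_app, Nat.add_1_r; reflexivity. }
  rewrite !Hrec; destruct (pol (map strip h)) as [i|]; [|reflexivity].
  destruct (nth (length h) A no_edge i); [|reflexivity].
  rewrite taken_strip, !Hrec; reflexivity.
Qed.

Lemma offline_value_in_order I pol :
  offline_value I (in_order_policy pol) = clair_value I pol.
Proof. unfold offline_value; rewrite offv_in_order; [reflexivity|reflexivity|simpl; lia]. Qed.

Lemma fold_right_rsum n (F : nat -> R) z :
  fold_right (fun i acc => acc + F i) z (seq 0 n) = z + rsum n F.
Proof.
revert z; induction n as [|n IH]; intros z; [simpl; ring|].
rewrite seq_S, fold_right_app; simpl; rewrite IH; ring.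
Qed.

Lemma rsum_single n f i : (i < n)%nat ->
  (forall j, (j < n)%nat -> j <> i -> f j = 0) -> rsum n f = f i.
Proof.
intros Hi H; rewrite (rsum_ext n f (fun j => f i * ind (Some i = Some j))).
- rewrite (rsum_ind_option n (fun _ => f i)); [reflexivity|intros j [= <-]; exact Hi].
- intros j Hj; destruct (Nat.eq_dec j i) as [->|Hne].
  + rewrite ind_true by reflexivity; ring.
  + rewrite ind_false by congruence; rewrite H by assumption; ring.
Qed.

(** For fixed perturbations Algorithm 1 is a deterministic in-order policy, so the coin coupling
    applies to it as to the benchmark. *)
Definition greedy_policy (n : nat) (r y : nat -> R) (A : list (nat -> option R)) : ClairPolicy :=
  fun h => greedy_choice n r y (nth (length h) A no_edge) h.

Lemma ov_greedy n r y rev rest h : length h = length rev ->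
  ov (greedy_alg y) n r rev rest h = cv (greedy_policy n r y (rev ++ rest)) n r rest h.
Proof.
revert rev h; induction rest as [|a rest IH]; intros rev h Hh; [reflexivity|].
simpl ov; simpl cv.
assert (Hrec : forall x, ov (greedy_alg y) n r (rev ++ [a]) rest (h ++ [x]) =
   cv (greedy_policy n r y (rev ++ a :: rest)) n r rest (h ++ [x])).
{ intros x; rewrite IH by (rewrite !length_app; simpl; lia).
  rewrite <- app_assoc; reflexivity. }
rewrite fold_right_rsum, Rplus_0_l.
unfold greedy_alg at 1 3; rewrite last_last.
unfold greedy_policy at 1; rewrite Hh, nth_middle.
assert (Hb := greedy_choice_best n r y a h).
destruct (greedy_choice n r y a h) as [i|]; simpl dirac.
- destruct Hb as ((Hi & Ha & Ht) & _).
  rewrite (rsum_single n _ i Hi).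
  + rewrite Nat.eqb_refl, !Hrec, Ht, (proj2 (Nat.ltb_lt i n) Hi); simpl.
    destruct (a i); [ring|congruence].
  + intros j _ Hj; rewrite (proj2 (Nat.eqb_neq i j)) by auto.
    destruct (a j); [|reflexivity]; destruct (taken h j); [reflexivity|ring].
- rewrite rsum_zero, Hrec; [ring|].
  intros j _; destruct (a j); [|reflexivity]; destruct (taken h j); [reflexivity|ring].
Qed.

Lemma online_value_greedy I y : online_value (greedy_alg y) I =
  offline_value I (in_order_policy (greedy_policy (nI I) (rw I) y (arrs I))).
Proof.
rewrite offline_value_in_order; unfold online_value, clair_value; rewrite ov_greedy; reflexivity.
Qed.

Lemma cnt_le o T i : (cnt o T i <= T)%nat.
Proof.
induction T as [|T IH]; simpl; [lia|].
unfold eqo; destruct (o T) as [j|]; [destruct (Nat.eqb i j)|]; lia.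
Qed.

(** On edges, [edge_wt] is [pT t] times [prio], and [pT t] is positive at an active arrival, so both
    order the resources alike. Availability means that the count is below [cap]. [P0] holds the part
    of the run made so far. *)
Lemma coin_run_greedy n r y A pI pT om f h m P0 :
  (forall t i p, (t < length A)%nat -> nth t A no_edge i = Some p -> p = pI i * pT t) ->
  (forall t, (t < length A)%nat -> om (O, t) = true -> 0 < pT t) ->
  in_order h -> (f + length h = length A)%nat ->
  (forall i, m i = cnt P0 (length h) i) ->
  (forall i, otaken h i = false <-> forall k, (k < m i)%nat -> om (S i, k) = false) ->
  exists P, (forall t, (t < length h)%nat -> P t = P0 t) /\
    (forall t, (length h <= t)%nat -> (t < length A)%nat ->
       is_best (fun j => (j < n)%nat /\ (nth t A no_edge j <> None /\ om (O, t) = true) /\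
           (cnt P t j < cap (fun k => om (S j, k)) (length A))%nat)
         (prio (fun i => pI i * r i) y) (P t)) /\
    rsum (length h) (fun t => wt (fun i => pI i * r i) (P0 t)) +
      coin_run (in_order_policy (greedy_policy n r y A)) n (fun i => pI i * r i) A f h m om =
    rsum (length A) (fun t => wt (fun i => pI i * r i) (P t)).
Proof.
intros Hdec Hpos; set (w := fun i => pI i * r i).
revert h m P0; induction f as [|f IH]; intros h m P0 Hh Hf Hm Htk.
{ exists P0; split; [auto|]; split; [intros; lia|].
  simpl in *; rewrite <- Hf; ring. }
set (t := length h) in *.
assert (Ht : (t < length A)%nat) by lia.
pose (c := greedy_choice n r y (nth t A no_edge) (map strip h)).
assert (Hc := greedy_choice_best n r y (nth t A no_edge) (map strip h)); fold c in Hc.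
(* An offer to an inactive arrival fails and uses no coin of the resource, so it is recorded as no
   offer. *)
pose (x := if om (O, t) then c else None).
assert (Hcap : forall j, (cnt P0 t j < cap (fun k => om (S j, k)) (length A))%nat <->
   taken (map strip h) j = false).
{ intros j; rewrite taken_strip, Htk, Hm; split.
  - intros H k Hk; apply (lt_cap_inv (fun k => om (S j, k)) (length A) _ k H Hk).
  - intros H; apply lt_cap; [|exact H]; assert (Hle := cnt_le P0 t j); lia. }
assert (Hx : is_best (fun j => (j < n)%nat /\ (nth t A no_edge j <> None /\ om (O, t) = true) /\
           (cnt P0 t j < cap (fun k => om (S j, k)) (length A))%nat) (prio w y) x).
{ unfold x; destruct (om (O, t)) eqn:Hom; [|simpl; intros j Hj; intuition discriminate].
  revert Hc; apply is_best_transport.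
  - intros j; rewrite Hcap; tauto.
  - assert (E : forall i, nth t A no_edge i <> None -> edge_wt (nth t A no_edge) r y i = pT t * prio w y i).
    { intros i Hi; unfold edge_wt, prio, w; destruct (nth t A no_edge i) eqn:Ha; [|congruence].
      rewrite (Hdec t i _ Ht Ha); ring. }
    specialize (Hpos t Ht Hom).
    intros i j (_ & Hi & _) (_ & Hj & _); unfold beats; rewrite !E by assumption.
    intros [B|[B1 B2]]; [left|right].
    + apply Rmult_lt_reg_l in B; assumption.
    + split; [apply Rmult_eq_reg_l in B1; [assumption|lra]|exact B2]. }
assert (Hstep : exists h' m' b, h' = h ++ [b] /\ in_order h' /\
   coin_run (in_order_policy (greedy_policy n r y A)) n w A (S f) h m om =
   wt w x + coin_run (in_order_policy (greedy_policy n r y A)) n w A f h' m' om /\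
   (forall i, m' i = (m i + eqo x i)%nat) /\
   (forall i, otaken h' i = false <-> forall k, (k < m' i)%nat -> om (S i, k) = false)).
{ simpl coin_run; fold t.
  rewrite (proj2 (Nat.ltb_lt _ _) Ht), processed_in_order by exact Hh; unfold t at 1.
  rewrite Nat.ltb_irrefl; simpl andb; cbv iota.
  unfold greedy_policy at 1; rewrite length_map; fold t; fold c.
  assert (Hno : forall o i, otaken (h ++ [(t, o, false)]) i = otaken h i).
  { intros o i; rewrite otaken_app; destruct o; apply orb_false_r. }
  destruct c as [i|] eqn:Ec; simpl in Hc.
  - destruct Hc as ((Hi & Ha & Hti) & _).
    rewrite legal_offer_id by (assumption || (rewrite <- taken_strip; assumption)).
    unfold x; destruct (om (O, t)) eqn:Hom.
    + exists (h ++ [(t, Some i, om (S i, m i))]), (incr m i); eexists; split; [reflexivity|].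
      split; [apply in_order_app, Hh|]; split; [reflexivity|]; split; [intros; apply incr_eqo|].
      intros j; rewrite otaken_app, orb_false_iff, Htk; unfold incr.
      destruct (Nat.eqb_spec j i) as [->|Hne].
      * rewrite andb_true_r; split.
        -- intros (H1 & H2) k Hk; destruct (Nat.eq_dec k (m i)) as [->|]; [exact H2|apply H1; lia].
        -- intros H; split; [intros k Hk|]; apply H; lia.
      * rewrite andb_false_r; tauto.
    + exists (h ++ [(t, Some i, false)]), m; eexists; split; [reflexivity|].
      split; [apply in_order_app, Hh|]; split; [simpl; ring|]; split; [intros; simpl; lia|].
      intros j; rewrite Hno; apply Htk.
  - assert (Ex : x = None) by (unfold x; destruct (om (O, t)); reflexivity).
    exists (h ++ [(t, None, false)]), m; eexists; split; [reflexivity|].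
    rewrite Ex; split; [apply in_order_app, Hh|]; split; [simpl; ring|]; split; [intros; simpl; lia|].
    intros j; rewrite Hno; apply Htk. }
destruct Hstep as (h' & m' & b & Eh & Hh' & Hrun & Hm' & Htk').
assert (Hl : length h' = S t) by (rewrite Eh, length_app; simpl; lia).
assert (Hc0 : forall i, cnt (assign P0 t x) t i = cnt P0 t i).
{ intros i; apply cnt_ext; intros s Hs; apply assign_neq; lia. }
destruct (IH h' m' (assign P0 t x)) as (P & HP1 & HP2 & HP3).
- exact Hh'.
- lia.
- intros i; rewrite Hl, Hm', Hm; simpl; rewrite assign_eq, Hc0; reflexivity.
- exact Htk'.
- rewrite Hl in HP1, HP2, HP3.
  assert (HPt : P t = x) by (rewrite HP1 by lia; apply assign_eq).
  assert (HPs : forall s, (s < t)%nat -> P s = P0 s).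
  { intros s Hs; rewrite HP1 by lia; apply assign_neq; lia. }
  exists P; split; [exact HPs|]; split.
  + intros s Hs1 Hs2; destruct (Nat.eq_dec s t) as [->|Hne]; [|apply HP2; lia].
    rewrite HPt; revert Hx; apply is_best_transport; [|auto].
    intros j; rewrite (cnt_ext P P0 t j HPs); reflexivity.
  + rewrite <- HP3, Hrun; simpl; rewrite assign_eq.
    rewrite (rsum_ext t (fun s => wt w (assign P0 t x s)) (fun s => wt w (P0 s))); [ring|].
    intros s Hs; rewrite assign_neq by lia; reflexivity.
Qed.

(** Both sides are expectations over the same coins. Once the average over perturbations is moved
    inside, the inequality holds outcome by outcome. *)
Lemma greedy_competitive_grid I pI pT pol N : (0 < N)%nat ->
  (forall i, (i < nI I)%nat -> 0 <= pI i <= 1) ->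
  (forall t, (t < length (arrs I))%nat -> 0 <= pT t <= 1) ->
  (forall t i p, (t < length (arrs I))%nat ->
     nth t (arrs I) no_edge i = Some p -> p = pI i * pT t) ->
  (forall i, 0 <= pI i * rw I i) ->
  (1 - exp (-1) - / INR N) * offline_value I pol <=
  gavg N (nI I) (fun y => online_value (greedy_alg y) I).
Proof.
intros HN HpI HpT Hdec Hw.
set (n := nI I) in *; set (A := arrs I) in *; set (T := length A) in *.
set (w := fun i => pI i * rw I i).
assert (Hexp : forall pol, offline_value I pol =
  expect (coin_prob pI pT) (all_coins n T) (coin_run pol n w A T [] (fun _ => O))).
{ intros pol'; symmetry; apply expect_coin_run; [exact Hdec|intros; lia]. }
replace (fun y => online_value (greedy_alg y) I) with (fun y =>
  expect (coin_prob pI pT) (all_coins n T)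
   (coin_run (in_order_policy (greedy_policy n (rw I) y A)) n w A T [] (fun _ => O))).
2:{ extensionality y; rewrite online_value_greedy, Hexp; reflexivity. }
rewrite gavg_expect, Hexp, <- expect_scal; apply expect_le.
{ intros [[|i] k] Hin; apply in_all_coins in Hin; [apply HpT|apply HpI]; lia. }
intros om Hom.
destruct (coin_run_path pol n w A om T [] (fun _ => O)) as (o & Ho & Hcap & ->).
{ intros i; unfold T; lia. }
{ intros i _ k Hk; lia. }
{ intros i; lia. }
assert (HP : forall y, exists P, greedy_run n T
   (fun t j => nth t A no_edge j <> None /\ om (O, t) = true)
   (fun j => cap (fun k => om (S j, k)) T) (prio w y) P /\
   coin_run (in_order_policy (greedy_policy n (rw I) y A)) n w A T [] (fun _ => O) om =
   rsum T (fun t => wt w (P t))).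
{ intros y; destruct (coin_run_greedy n (rw I) y A pI pT om T [] (fun _ => O) (fun _ => None))
    as (P & _ & HP1 & HP2); auto.
  - intros t Ht E; specialize (HpT t Ht); specialize (Hom (O, t)); simpl in Hom.
    destruct (Req_dec (pT t) 0) as [H0|]; [rewrite Hom in E by exact H0; discriminate|lra].
  - reflexivity.
  - simpl; unfold T; lia.
  - intros i; simpl; split; [intros; lia|reflexivity].
  - exists P; split; [intros t Ht; apply HP1; simpl; [lia|exact Ht]|].
    unfold w, T; rewrite <- HP2; symmetry; apply Rplus_0_l. }
apply functional_choice in HP; destruct HP as (P & HP).
replace (fun y => coin_run _ n w A T [] (fun _ => O) om) with (fun y => rsum T (fun t => wt w (P y t))).
2:{ extensionality y; symmetry; apply HP. }
apply (greedy_run_competitive N n T (fun t j => nth t A no_edge j <> None /\ om (O, t) = true)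
   (fun j => cap (fun k => om (S j, k)) T)); auto.
- intros y; apply HP.
- intros t i Ht E; destruct (Ho t i E) as (_ & _ & H); tauto.
Qed.

(** * Bounded variation of the reward in each perturbation *)

Lemma grid_bv_monotone u : (forall x y, x <= y -> u x <= u y) -> u 1 - u 0 <= 1 -> grid_bv 1 u.
Proof.
intros Hu H01 N s t HN Hs Ht.
apply Rle_trans with (rsum N (fun k => u (gridpt N (S k)) - u (gridpt N k))).
- apply rsum_le; intros k Hk; specialize (Hs k Hk); specialize (Ht k Hk).
  assert (H1 := Hu _ _ (proj1 Hs)); assert (H2 := Hu _ _ (proj2 Hs)).
  assert (H3 := Hu _ _ (proj1 Ht)); assert (H4 := Hu _ _ (proj2 Ht)).
  apply Rabs_le; lra.
- rewrite (rsum_telescope N (fun k => u (gridpt N k))), gridpt_0, gridpt_N by exact HN; exact H01.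
Qed.

Lemma ind_le (P Q : Prop) : (P -> Q) -> ind P <= ind Q.
Proof.
intros H; destruct (classic P) as [p|p]; [rewrite !ind_true by auto; lra|].
rewrite (ind_false P p); apply ind_ge0.
Qed.

Lemma ind_le1 (P : Prop) : ind P <= 1.
Proof. rewrite <- (ind_true True I); apply ind_le; auto. Qed.

Lemma ind_diff (P Q : Prop) : ~ (P <-> Q) -> Rabs (ind P - ind Q) = 1.
Proof.
intros H; destruct (classic P), (classic Q); try tauto;
  [rewrite (ind_true P), (ind_false Q)|rewrite (ind_false P), (ind_true Q)]; trivial;
  [rewrite Rabs_pos_eq|rewrite Rabs_left]; lra.
Qed.

Lemma cv_bound pol n r B rest h :
  (forall i, (i < n)%nat -> 0 <= r i <= B) -> 0 <= B ->
  (forall a, In a rest -> forall i p, a i = Some p -> 0 <= p <= 1) ->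
  0 <= cv pol n r rest h <= INR (length rest) * B.
Proof.
intros Hr HB; revert h; induction rest as [|a rest IH]; intros h Ha; [simpl; lra|].
assert (IH' := fun h => IH h (fun a Hin => Ha a (or_intror Hin))); clear IH.
simpl cv; simpl length; rewrite S_INR.
assert (Hskip : 0 <= cv pol n r rest (h ++ [(None, false)]) <= (INR (length rest) + 1) * B).
{ specialize (IH' (h ++ [(None, false)])); lra. }
destruct (pol h) as [i|]; [|exact Hskip].
destruct (a i) as [p|] eqn:Hp; [|exact Hskip].
destruct (Nat.ltb_spec i n) as [Hi|]; simpl; [|exact Hskip].
destruct (taken h i); simpl; [exact Hskip|].
assert (Hp' := Ha a (or_introl eq_refl) i p Hp); specialize (Hr i Hi).
assert (H1 := IH' (h ++ [(Some i, true)])); assert (H2 := IH' (h ++ [(Some i, false)])).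
set (c1 := cv pol n r rest (h ++ [(Some i, true)])) in *.
set (c2 := cv pol n r rest (h ++ [(Some i, false)])) in *.
split.
- apply Rplus_le_le_0_compat; apply Rmult_le_pos; lra.
- apply Rle_trans with (p * (B + INR (length rest) * B) + (1 - p) * (B + INR (length rest) * B));
   [|right; ring].
  apply Rplus_le_compat; apply Rmult_le_compat_l; lra.
Qed.

Lemma bounded_range n (r : nat -> R) : exists B, 0 <= B /\ forall i, (i < n)%nat -> r i <= B.
Proof.
exists (rsum n (fun i => Rabs (r i))); split; [apply rsum_ge0; intros; apply Rabs_pos|].
intros i Hi; eapply Rle_trans; [apply Rle_abs|].
apply (rsum_term_le n (fun i => Rabs (r i))); [exact Hi|intros; apply Rabs_pos].
Qed.

Lemma cv_ext pol pol' n r rest h :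
  (forall h', (length h' < length h + length rest)%nat -> pol h' = pol' h') ->
  cv pol n r rest h = cv pol' n r rest h.
Proof.
revert h; induction rest as [|a rest IH]; intros h H; [reflexivity|simpl].
assert (Hrec : forall x, cv pol n r rest (h ++ [x]) = cv pol' n r rest (h ++ [x])).
{ intros x; apply IH; intros h' Hh'; apply H; rewrite length_app in Hh'; simpl in *; lia. }
rewrite H, !Hrec by (simpl; lia).
destruct (pol' h) as [i|]; [|reflexivity]; rewrite !Hrec; reflexivity.
Qed.

(* As a function of [y k], the run only depends on the outcome of finitely many comparisons
   between the bid of [k] and another bid, each of which is monotone in [y k]. *)
Lemma online_value_greedy_bv I : wf_inst I ->
  exists V, forall k y, (k < nI I)%nat -> grid_bv V (fun x => online_value (greedy_alg (upd y k x)) I).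
Proof.
intros (Hr & HA); set (n := nI I) in *; set (r := rw I) in *; set (A := arrs I) in *.
destruct (bounded_range n r) as (B & HB & HrB).
assert (HAn : forall t i p, (t < length A)%nat -> nth t A no_edge i = Some p -> (i < n)%nat /\ 0 <= p <= 1).
{ intros t i p Ht; apply HA, nth_In, Ht. }
pose (M := INR (length A) * B).
assert (HM0 : 0 <= M) by (apply Rmult_le_pos; [apply pos_INR|exact HB]).
assert (HM : forall y, 0 <= online_value (greedy_alg y) I <= M).
{ intros y; rewrite online_value_greedy, offline_value_in_order; apply cv_bound; [|exact HB|].
  - intros i Hi; specialize (Hr i Hi); specialize (HrB i Hi); unfold r in *; lra.
  - intros a Ha i p Hp; apply (HA a Ha i p Hp). }
(* A change of the run costs at most [M]; per arrival and resource there are two comparisons, each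
   of variation at most 1. *)
exists (M * (INR (length A) * (INR n * 2))); intros k y Hk.
pose (ew := fun t x j => edge_wt (nth t A no_edge) r (upd y k x) j).
(* Both strict comparisons are needed to detect ties. The argument 0 is an arbitrary reference, as
   the bid of [j <> k] does not depend on it. *)
pose (lo := fun t j x => ind (ew t 0 j < ew t x k)).
pose (up := fun t j x => ind (ew t x k < ew t 0 j)).
assert (Hew : forall t j x x', j <> k -> ew t x j = ew t x' j).
{ intros t j x x' Hj; unfold ew, edge_wt, upd; rewrite (proj2 (Nat.eqb_neq j k) Hj); reflexivity. }
assert (Hmono : forall t x x', (t < length A)%nat -> x <= x' -> ew t x' k <= ew t x k).
{ intros t x x' Ht Hx; unfold ew, edge_wt, upd; rewrite Nat.eqb_refl.
  destruct (nth t A no_edge k) as [p|] eqn:Hp; [|lra].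
  apply Rmult_le_compat_l; [|apply gfun_incr in Hx; lra].
  destruct (HAn t k p Ht Hp) as (_ & Hp'); specialize (Hr k Hk); apply Rmult_le_pos; lra. }
assert (Hdiff : forall s x, Rabs (online_value (greedy_alg (upd y k s)) I -
     online_value (greedy_alg (upd y k x)) I) <=
   M * rsum (length A) (fun t => rsum n (fun j => Rabs (lo t j s - lo t j x) + Rabs (up t j s - up t j x)))).
{ intros s x.
  assert (Hpos : forall t j, 0 <= Rabs (lo t j s - lo t j x) + Rabs (up t j s - up t j x)).
  { intros t j; apply Rplus_le_le_0_compat; apply Rabs_pos. }
  (* Either some comparison changes and the right side is at least [M], or none does and the two
     runs make identical choices. *)
  destruct (classic (exists t j, (t < length A)%nat /\ (j < n)%nat /\
     ~ ((ew t 0 j < ew t s k <-> ew t 0 j < ew t x k) /\ (ew t s k < ew t 0 j <-> ew t x k < ew t 0 j))))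
    as [(t & j & Ht & Hj & Hne)|Hall].
  - apply Rle_trans with (M * 1).
    { rewrite Rmult_1_r; assert (H1 := HM (upd y k s)); assert (H2 := HM (upd y k x)).
      apply Rabs_le; lra. }
    apply Rmult_le_compat_l; [exact HM0|].
    apply Rle_trans with (rsum n (fun j => Rabs (lo t j s - lo t j x) + Rabs (up t j s - up t j x))).
    2:{ apply (rsum_term_le (length A) (fun t => rsum n
           (fun j => Rabs (lo t j s - lo t j x) + Rabs (up t j s - up t j x)))); [exact Ht|].
        intros; apply rsum_ge0; intros; apply Hpos. }
    apply Rle_trans with (Rabs (lo t j s - lo t j x) + Rabs (up t j s - up t j x)).
    2:{ apply (rsum_term_le n (fun j => Rabs (lo t j s - lo t j x) + Rabs (up t j s - up t j x)));
        [exact Hj|intros; apply Hpos]. }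
    assert (P1 := Rabs_pos (lo t j s - lo t j x)); assert (P2 := Rabs_pos (up t j s - up t j x)).
    apply not_and_or in Hne; destruct Hne as [Hne|Hne]; apply ind_diff in Hne; unfold lo, up in *; lra.
  - replace (online_value (greedy_alg (upd y k s)) I) with (online_value (greedy_alg (upd y k x)) I).
    { rewrite Rminus_diag, Rabs_R0; apply Rmult_le_pos; [exact HM0|].
      apply rsum_ge0; intros; apply rsum_ge0; intros; apply Hpos. }
    rewrite !online_value_greedy, !offline_value_in_order; apply cv_ext.
    fold n r A; simpl; intros h Hh; unfold greedy_policy.
    eapply is_best_unique; [apply greedy_choice_best|].
    generalize (greedy_choice_best n r (upd y k s) (nth (length h) A no_edge) h).
    apply is_best_transport; [tauto|].
    assert (Hkj : forall j, (j < n)%nat -> j <> k ->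
      (ew (length h) s j < ew (length h) s k <-> ew (length h) x j < ew (length h) x k) /\
      (ew (length h) s k < ew (length h) s j <-> ew (length h) x k < ew (length h) x j)).
    { intros j Hj Hjk; apply NNPP; intros Hno; apply Hall; exists (length h), j.
      rewrite (Hew _ _ s 0), (Hew _ _ x 0) in Hno by exact Hjk; auto. }
    fold (ew (length h) s) (ew (length h) x); set (t := length h) in *.
    assert (Hs : forall j, edge_wt (nth t A no_edge) r (upd y k s) j = ew t s j) by reflexivity.
    assert (Hx : forall j, edge_wt (nth t A no_edge) r (upd y k x) j = ew t x j) by reflexivity.
    intros i j (Hi & _) (Hj & _); unfold beats; rewrite !Hs, !Hx.
    assert (Heq : forall a b a' b' : R, (a < b <-> a' < b') -> (b < a <-> b' < a') ->
       (a < b \/ a = b /\ (i < j)%nat) -> (a' < b' \/ a' = b' /\ (i < j)%nat)).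
    { intros a b a' b' E1 E2 [H|[H H']]; [left; tauto|right; split; [|exact H']].
      destruct (Rtotal_order a' b') as [L|[L|L]]; [|exact L|].
      - apply E1 in L; lra.
      - apply E2 in L; lra. }
    destruct (Nat.eq_dec i k) as [->|Hik], (Nat.eq_dec j k) as [->|Hjk].
    + intros [H|[_ H]]; [lra|lia].
    + apply Heq; apply Hkj; assumption.
    + apply Heq; apply Hkj; assumption.
    + rewrite (Hew t i s x), (Hew t j s x) by assumption; tauto. }
intros N s u HN Hs Hu.
eapply Rle_trans; [apply rsum_le; intros j _; apply Hdiff|].
rewrite rsum_scal; apply Rmult_le_compat_l; [exact HM0|].
rewrite rsum_swap, <- rsum_const; apply rsum_le; intros t Ht.
rewrite rsum_swap, <- rsum_const; apply rsum_le; intros j Hj.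
rewrite rsum_plus; replace 2 with (1 + 1) by ring; apply Rplus_le_compat.
- assert (H : grid_bv 1 (fun x => - lo t j x)).
  { apply grid_bv_monotone; unfold lo.
    - intros x x' Hx; apply Ropp_le_contravar, ind_le; specialize (Hmono t x x' Ht Hx); lra.
    - assert (H0 := ind_le1 (ew t 0 j < ew t 0 k)); assert (H1 := ind_ge0 (ew t 0 j < ew t 1 k)); lra. }
  specialize (H N s u HN Hs Hu); eapply Rle_trans; [|exact H].
  right; apply rsum_ext; intros l _; rewrite <- Rabs_Ropp; f_equal; ring.
- apply grid_bv_monotone with (u := up t j); auto; unfold up.
  + intros x x' Hx; apply ind_le; specialize (Hmono t x x' Ht Hx); lra.
  + assert (H0 := ind_ge0 (ew t 0 k < ew t 0 j)); assert (H1 := ind_le1 (ew t 1 k < ew t 0 j)); lra.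
Qed.

Lemma greedy_competitive I : wf_inst I -> decomposable I ->
  exists v, cube_int (nI I) (fun y => online_value (greedy_alg y) I) v /\
    forall pol, (1 - exp (-1)) * offline_value I pol <= v.
Proof.
intros Hwf (pI & pT & HpI & HpT & Hdec).
destruct (online_value_greedy_bv I Hwf) as (V & HV).
destruct (cube_int_exists (nI I) V (fun y => online_value (greedy_alg y) I) HV) as (v & Hv & HvN).
exists v; split; [exact Hv|]; intros pol.
(* Beyond the actual resources [pI] and [rw] are unconstrained; the value 0 makes every weight
   nonnegative. *)
pose (pI' := fun i => if (i <? nI I)%nat then pI i else 0).
apply (le_of_le_inv_N _ _ (offline_value I pol + INR (nI I) * (V + 1))); intros N HN.
assert (H : (1 - exp (-1) - / INR N) * offline_value I pol <=
  gavg N (nI I) (fun y => online_value (greedy_alg y) I)).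
{ apply (greedy_competitive_grid I pI' pT); auto; unfold pI'.
  - intros i Hi; rewrite (proj2 (Nat.ltb_lt _ _) Hi); auto.
  - intros t i p Ht Hp; destruct Hwf as (_ & HA).
    destruct (HA _ (nth_In _ no_edge Ht) i p Hp) as (Hi & _).
    rewrite (proj2 (Nat.ltb_lt _ _) Hi); auto.
  - intros i; destruct (Nat.ltb_spec i (nI I)) as [Hi|]; [|lra].
    destruct Hwf as (Hr & _); specialize (Hr i Hi); specialize (HpI i Hi); apply Rmult_le_pos; lra. }
specialize (HvN N HN).
assert (Hab := Rle_abs (- (v - gavg N (nI I) (fun y => online_value (greedy_alg y) I)))).
rewrite Rabs_Ropp in Hab; unfold Rdiv in *; lra.
Qed.

(** * Hardness *)

(** Same recursion as [ov], but averaging a functional of the final history; with [tk i] it gives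
    the probability that [i] is matched. *)
Fixpoint final_expect (alg : OnlineAlg) (n : nat) (r : nat -> R)
    (rev rest : list (nat -> option R)) (h : hist) (F : hist -> R) : R :=
  match rest with
  | [] => F h
  | a :: rest' =>
      alg n r (rev ++ [a]) h None *
        final_expect alg n r (rev ++ [a]) rest' (h ++ [(None, false)]) F +
      rsum n (fun i => match a i with
        | Some p => if taken h i then 0 else
            alg n r (rev ++ [a]) h (Some i) *
            (p * final_expect alg n r (rev ++ [a]) rest' (h ++ [(Some i, true)]) F +
             (1 - p) * final_expect alg n r (rev ++ [a]) rest' (h ++ [(Some i, false)]) F)
        | None => 0 end)
  end.

(** This is where the algorithm being online enters: decisions on the prefix depend on revealed
    arrivals only, so the adversary may append one without altering them. *)
Lemma final_expect_snoc alg n r rev rest a h F :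
  final_expect alg n r rev (rest ++ [a]) h F =
  final_expect alg n r rev rest h (fun h' => final_expect alg n r (rev ++ rest) [a] h' F).
Proof.
revert rev h; induction rest as [|b rest IH]; intros rev h.
- rewrite app_nil_r; reflexivity.
- assert (E : (rev ++ [b]) ++ rest = rev ++ b :: rest) by (rewrite <- app_assoc; reflexivity).
  cbn [app]; cbn [final_expect]; f_equal.
  + rewrite IH, E; reflexivity.
  + apply rsum_ext; intros i _; rewrite !IH, E; reflexivity.
Qed.

Definition prob_edges (l : list (nat -> option R)) : Prop :=
  forall a, In a l -> forall i p, a i = Some p -> 0 <= p <= 1.

Lemma prob_edges_tail a l : prob_edges (a :: l) -> prob_edges l.
Proof. intros H b Hb; apply H; right; exact Hb. Qed.

Lemma final_expect_le alg n r rev rest h F G : valid_alg alg -> prob_edges rest ->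
  (forall h, F h <= G h) ->
  final_expect alg n r rev rest h F <= final_expect alg n r rev rest h G.
Proof.
intros Halg Hp HFG; revert rev h Hp; induction rest as [|a rest IH]; intros rev h Hp; [apply HFG|].
destruct (Halg n r (rev ++ [a]) h) as (Hd & _).
assert (IH' := fun rev h => IH rev h (prob_edges_tail _ _ Hp)); simpl; apply Rplus_le_compat.
- apply Rmult_le_compat_l; auto.
- apply rsum_le; intros i _; destruct (a i) as [p|] eqn:Hi; [|lra].
  destruct (taken h i); [lra|].
  assert (Hpi := Hp a (or_introl eq_refl) i p Hi).
  apply Rmult_le_compat_l; [apply Hd|]; apply Rplus_le_compat; apply Rmult_le_compat_l; auto; lra.
Qed.

Lemma final_expect_affine alg n r rev rest h F c : valid_alg alg ->
  final_expect alg n r rev rest h (fun h => F h + c) = final_expect alg n r rev rest h F + c.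
Proof.
intros Halg; revert rev h; induction rest as [|a rest IH]; intros rev h; [reflexivity|].
destruct (Halg n r (rev ++ [a]) h) as (_ & Hs); rewrite fold_right_rsum, Rplus_0_l, last_last in Hs.
simpl; rewrite IH.
set (d := alg n r (rev ++ [a]) h) in *.
set (e := fun i => match a i with
   | Some _ => if taken h i then 0 else d (Some i) | None => 0 end) in Hs.
assert (Hc : d None * c + rsum n (fun i => c * e i) = c).
{ rewrite rsum_scal; transitivity (c * (d None + rsum n e)); [ring|rewrite Hs; ring]. }
match goal with |- _ + ?X = _ + ?Y + _ =>
  cut (X = Y + rsum n (fun i => c * e i)); [intros ->; lra|] end.
unfold e; rewrite <- rsum_plus; apply rsum_ext; intros i _.
destruct (a i); [|ring]; destruct (taken h i); [ring|rewrite !IH; ring].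
Qed.

Lemma final_expect_const alg n r rev rest h c : valid_alg alg ->
  final_expect alg n r rev rest h (fun _ => c) = c.
Proof.
intros Halg.
assert (H0 : final_expect alg n r rev rest h (fun _ => 0) = 0).
{ revert rev h; induction rest as [|a rest IH]; intros rev h; [reflexivity|simpl].
  rewrite IH, rsum_zero; [ring|]; intros i _.
  destruct (a i); [|reflexivity]; destruct (taken h i); [reflexivity|rewrite !IH; ring]. }
transitivity (final_expect alg n r rev rest h (fun _ => 0 + c)).
- f_equal; extensionality h'; ring.
- rewrite (final_expect_affine alg n r rev rest h (fun _ => 0) c Halg), H0; ring.
Qed.

Lemma final_expect_plus alg n r rev rest h F G :
  final_expect alg n r rev rest h (fun h => F h + G h) =
  final_expect alg n r rev rest h F + final_expect alg n r rev rest h G.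
Proof.
revert rev h; induction rest as [|a rest IH]; intros rev h; [reflexivity|simpl].
match goal with |- _ + ?X = (_ + ?Y) + (_ + ?Z) =>
  replace X with (Y + Z); [rewrite IH; ring|] end.
rewrite <- rsum_plus; apply rsum_ext; intros i _.
destruct (a i); [|ring]; destruct (taken h i); [ring|rewrite !IH; ring].
Qed.

Lemma final_expect_rsum alg n r rev rest h m (F : nat -> hist -> R) : valid_alg alg ->
  final_expect alg n r rev rest h (fun h => rsum m (fun i => F i h)) =
  rsum m (fun i => final_expect alg n r rev rest h (F i)).
Proof.
intros Halg; induction m as [|m IH]; simpl; [apply final_expect_const, Halg|].
rewrite <- IH; apply final_expect_plus.
Qed.

Lemma final_expect_last_le alg n r rev a h F c : valid_alg alg -> prob_edges [a] ->
  F (h ++ [(None, false)]) <= c ->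
  (forall i b, a i <> None -> taken h i = false -> F (h ++ [(Some i, b)]) <= c) ->
  final_expect alg n r rev [a] h F <= c.
Proof.
intros Halg Hp H0 H1; destruct (Halg n r (rev ++ [a]) h) as (Hd & _).
rewrite <- (final_expect_const alg n r rev [a] h c Halg); simpl; apply Rplus_le_compat.
- apply Rmult_le_compat_l; auto.
- apply rsum_le; intros i _; destruct (a i) as [p|] eqn:Hi; [|lra].
  destruct (taken h i) eqn:Ht; [lra|].
  assert (Hpi := Hp a (or_introl eq_refl) i p Hi).
  apply Rmult_le_compat_l; [apply Hd|].
  apply Rplus_le_compat; (apply Rmult_le_compat_l; [lra|]; apply H1; congruence).
Qed.

Definition tk (i : nat) (h : hist) : R := if taken h i then 1 else 0.

Lemma taken_app h o b i : taken (h ++ [(o, b)]) i =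
  taken h i || match o with Some j => b && Nat.eqb i j | None => false end.
Proof.
unfold taken; rewrite existsb_app; simpl; rewrite orb_false_r.
destruct o as [j|], b; reflexivity.
Qed.

Lemma tk_app h o b i : (forall j, o = Some j -> taken h j = false) ->
  tk i (h ++ [(o, b)]) = tk i h + if b then ind (o = Some i) else 0.
Proof.
intros Ho; unfold tk; rewrite taken_app; destruct o as [j|].
- specialize (Ho j eq_refl); destruct b; simpl.
  + destruct (Nat.eqb_spec i j) as [->|Hne].
    * rewrite Ho, ind_true by reflexivity; simpl; ring.
    * rewrite ind_false, orb_false_r by congruence; ring.
  + rewrite orb_false_r; ring.
- rewrite orb_false_r; destruct b; [rewrite ind_false by discriminate|]; ring.
Qed.

Lemma rsum_tk_app n h o b : (forall j, o = Some j -> (j < n)%nat /\ taken h j = false) ->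
  rsum n (fun i => tk i (h ++ [(o, b)])) = rsum n (fun i => tk i h) + if b then wt (fun _ => 1) o else 0.
Proof.
intros Ho; rewrite (rsum_ext n _ (fun i => tk i h + if b then 1 * ind (o = Some i) else 0)).
2:{ intros i _; rewrite tk_app by apply Ho; destruct b; ring. }
rewrite rsum_plus; f_equal; destruct b; [apply rsum_ind_option, Ho|apply rsum_zero; auto].
Qed.

(** With unit rewards, the reward still to come is the growth in the number of taken resources. *)
Lemma ov_final_expect alg n rev rest h : valid_alg alg ->
  ov alg n (fun _ => 1) rev rest h + rsum n (fun i => tk i h) =
  final_expect alg n (fun _ => 1) rev rest h (fun h => rsum n (fun i => tk i h)).
Proof.
intros Halg; revert rev h; induction rest as [|a rest IH]; intros rev h; [simpl; ring|].
destruct (Halg n (fun _ => 1) (rev ++ [a]) h) as (_ & Hs).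
rewrite fold_right_rsum, Rplus_0_l, last_last in Hs.
simpl; rewrite fold_right_rsum, Rplus_0_l.
set (d := alg n (fun _ => 1) (rev ++ [a]) h) in *.
set (k := rsum n (fun i => tk i h)).
rewrite <- IH, rsum_tk_app by discriminate; fold k.
set (e := fun i => match a i with
   | Some _ => if taken h i then 0 else d (Some i) | None => 0 end) in Hs.
assert (Hc : d None * k + rsum n (fun i => k * e i) = k).
{ rewrite rsum_scal; transitivity (k * (d None + rsum n e)); [ring|rewrite Hs; ring]. }
match goal with |- _ + ?X + _ = _ + ?Y =>
  cut (X + rsum n (fun i => k * e i) = Y); [intros <-; lra|] end.
unfold e; rewrite <- rsum_plus; apply rsum_ext; intros i Hi.
destruct (a i); [|ring]; destruct (taken h i) eqn:Ht; [ring|].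
rewrite <- !IH, !rsum_tk_app by (intros j [= <-]; auto); fold k; simpl; ring.
Qed.

Definition match_prob (alg : OnlineAlg) (n : nat) (A : list (nat -> option R)) (i : nat) : R :=
  final_expect alg n (fun _ => 1) [] A [] (tk i).

Lemma online_value_match_prob alg n A : valid_alg alg ->
  online_value alg (mkInst n (fun _ => 1) A) = rsum n (match_prob alg n A).
Proof.
intros Halg; unfold match_prob; rewrite <- final_expect_rsum, <- ov_final_expect by exact Halg.
unfold online_value; simpl; rewrite (rsum_zero n (fun i => tk i [])) by reflexivity; ring.
Qed.

Lemma tk_01 i h : 0 <= tk i h <= 1.
Proof. unfold tk; destruct (taken h i); lra. Qed.

Lemma match_prob_le1 alg n A i : valid_alg alg -> prob_edges A -> match_prob alg n A i <= 1.
Proof.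
intros Halg Hp; rewrite <- (final_expect_const alg n (fun _ => 1) [] A [] 1 Halg).
apply final_expect_le; auto; intros; apply tk_01.
Qed.

Lemma prob_edges_app A a : prob_edges (A ++ [a]) -> prob_edges A /\ prob_edges [a].
Proof.
intros H; split; intros b Hb; apply H, in_or_app; [left|right]; exact Hb.
Qed.

(** Freezes the mass of a resource once the adversary has removed it. *)
Lemma match_prob_no_edge alg n A a i : valid_alg alg -> prob_edges (A ++ [a]) -> a i = None ->
  match_prob alg n (A ++ [a]) i = match_prob alg n A i.
Proof.
intros Halg Hp Ha; destruct (prob_edges_app _ _ Hp) as (HpA & Hpa).
unfold match_prob; rewrite final_expect_snoc.
assert (Hne : forall h o b, (forall j, o = Some j -> a j <> None /\ taken h j = false) ->
   tk i (h ++ [(o, b)]) = tk i h).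
{ intros h o b Ho; rewrite tk_app by apply Ho; destruct b; [|ring].
  rewrite ind_false; [ring|]; intros ->; destruct (Ho i eq_refl); congruence. }
apply Rle_antisym; apply final_expect_le; auto; intros h.
- apply final_expect_last_le; auto.
  + right; apply Hne; discriminate.
  + intros j b Hj Ht; right; apply Hne; intros j' [= <-]; auto.
(* The lower bound is the upper bound applied to [1 - tk i]. *)
- assert (H : final_expect alg n (fun _ => 1) ([] ++ A) [a] h (fun h' => 1 - tk i h') <= 1 - tk i h).
  { apply final_expect_last_le; auto.
    + right; rewrite Hne; [reflexivity|discriminate].
    + intros j b Hj Ht; right; rewrite Hne; [reflexivity|intros j' [= <-]; auto]. }
  assert (E : final_expect alg n (fun _ => 1) ([] ++ A) [a] h (fun h' => (1 - tk i h') + tk i h') = 1).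
  { etransitivity; [|apply (final_expect_const alg n (fun _ => 1) ([] ++ A) [a] h 1 Halg)].
    f_equal; extensionality h'; ring. }
  rewrite final_expect_plus in E; lra.
Qed.

Lemma match_prob_total_step alg n A a : valid_alg alg -> prob_edges (A ++ [a]) ->
  (forall i, a i <> None -> (i < n)%nat) ->
  rsum n (match_prob alg n (A ++ [a])) <= rsum n (match_prob alg n A) + 1.
Proof.
intros Halg Hp Ha; destruct (prob_edges_app _ _ Hp) as (HpA & Hpa).
unfold match_prob; rewrite <- !final_expect_rsum, final_expect_snoc, <- final_expect_affine by exact Halg.
apply final_expect_le; auto; intros h; apply final_expect_last_le; auto.
- rewrite rsum_tk_app by discriminate; lra.
- intros i b Hi Ht; rewrite rsum_tk_app by (intros j [= <-]; auto); destruct b; simpl; lra.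
Qed.

(** * The adversary and its perfect matching *)

Definition set_arrival (S : nat -> bool) : nat -> option R :=
  fun i => if S i then Some 1 else None.

(* The adversary connects each arrival to the set [S] of remaining resources and then removes
   from [S] the one that is least likely to be matched so far.  The mass of removed
   resources is at most [beta t]: removal of the minimum [m] over [n - t] resources
   gives [(n - t) m + (mass removed before) <= t + 1]. *)
Lemma adversary alg n (beta : nat -> R) : valid_alg alg -> 0 <= beta O ->
  (forall t, (t < n)%nat -> beta t + 1 <= beta (S t) \/
     INR t + 1 + (INR n - INR t - 1) * beta t <= (INR n - INR t) * beta (S t)) ->
  forall t, (t <= n)%nat -> exists A rho (S : nat -> bool),
    length A = t /\
    (forall a, In a A -> forall i p, a i = Some p -> (i < n)%nat /\ p = 1) /\
    (forall s, (s < t)%nat -> nth s A no_edge (rho s) = Some 1) /\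
    (forall s s', (s < s')%nat -> (s' < t)%nat -> rho s <> rho s') /\
    (forall i, S i = true -> (i < n)%nat /\ forall s, (s < t)%nat -> rho s <> i) /\
    rsum n (fun i => ind (S i = true)) = INR n - INR t /\
    rsum n (match_prob alg n A) <= INR t /\
    rsum n (fun i => match_prob alg n A i * (1 - ind (S i = true))) <= beta t.
Proof.
intros Halg Hb0 Hb; induction t as [|t IH]; intros Ht.
{ exists [], (fun _ => O), (fun i => (i <? n)%nat).
  repeat split; try (intros; simpl in *; contradiction || lia); simpl.
  - apply Nat.ltb_lt; assumption.
  - rewrite (rsum_ext n _ (fun _ => 1)), rsum_const; [ring|].
    intros i Hi; apply ind_true, Nat.ltb_lt, Hi.
  - right; apply rsum_zero; reflexivity.
  - apply Rle_trans with 0; [right|exact Hb0].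
    apply rsum_zero; intros i Hi; unfold match_prob; simpl; unfold tk; simpl; ring. }
destruct (IH ltac:(lia)) as (A & rho & Q & HA & HAe & Hrho & Hinj & HS & Hcard & Htot & Hrem); clear IH.
set (a := set_arrival Q); set (A' := A ++ [a]).
assert (Hae : forall i p, a i = Some p -> Q i = true /\ (i < n)%nat /\ p = 1).
{ unfold a, set_arrival; intros i p; destruct (Q i) eqn:E; [|discriminate].
  intros [= <-]; split; [reflexivity|]; split; [apply HS, E|reflexivity]. }
assert (HA'e : forall b, In b A' -> forall i p, b i = Some p -> (i < n)%nat /\ p = 1).
{ intros b Hb'; apply in_app_or in Hb'; destruct Hb' as [Hb'|[<-|[]]]; [apply HAe, Hb'|].
  intros i p Hp; apply Hae in Hp; tauto. }
assert (Hp : prob_edges A').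
{ intros b Hb' i p Hp; destruct (HA'e b Hb' i p Hp) as (_ & ->); lra. }
set (q := match_prob alg n A').
assert (Htot' : rsum n q <= INR t + 1).
{ eapply Rle_trans; [apply match_prob_total_step; auto|lra].
  intros i Hi; destruct (a i) eqn:E; [apply Hae in E; tauto|congruence]. }
assert (Hq : forall i, Q i = false -> q i = match_prob alg n A i).
{ intros i Hi; apply match_prob_no_edge; auto; unfold a, set_arrival; rewrite Hi; reflexivity. }
destruct (is_best_exists n (fun i => (i < n)%nat /\ Q i = true) (fun i => - q i)) as (o & Ho); [tauto|].
assert (Hnt : 0 < INR n - INR t) by (apply Rlt_0_minus, lt_INR; lia).
destruct o as [k|]; simpl in Ho.
2:{ rewrite rsum_zero in Hcard; [lra|].
    intros i Hi; apply ind_false; intros E; apply (Ho i); auto. }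
destruct Ho as ((Hk & HQk) & Hmin).
assert (Hmin' : forall i, (i < n)%nat -> Q i = true -> q k <= q i).
{ intros i Hi HQ; destruct (Hmin i (conj Hi HQ)) as [->|B]; [lra|apply beats_le in B; lra]. }
assert (Hq1 : q k <= 1) by (apply match_prob_le1; auto).
pose (Q' := fun i => Q i && negb (Nat.eqb i k)).
assert (HQ' : forall i, ind (Q' i = true) = ind (Q i = true) - ind (Some k = Some i)).
{ intros i; unfold Q'; destruct (Nat.eqb_spec i k) as [->|Hne].
  - rewrite andb_false_r, HQk, ind_false by discriminate; rewrite !ind_true by reflexivity; ring.
  - rewrite andb_true_r, (ind_false (Some k = Some i)) by congruence; ring. }
assert (Hold : rsum n (fun i => q i * (1 - ind (Q i = true))) =
  rsum n (fun i => match_prob alg n A i * (1 - ind (Q i = true)))).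
{ apply rsum_ext; intros i _; destruct (Q i) eqn:E; [rewrite ind_true by reflexivity; ring|].
  rewrite Hq by exact E; reflexivity. }
set (m := rsum n (fun i => match_prob alg n A i * (1 - ind (Q i = true)))) in *.
assert (Hnew : rsum n (fun i => q i * (1 - ind (Q' i = true))) = m + q k).
{ rewrite <- Hold.
  replace (q k) with (rsum n (fun i => q i * ind (Some k = Some i)))
    by (apply (rsum_ind_option n q); intros i [= <-]; exact Hk).
  rewrite <- rsum_plus; apply rsum_ext; intros i _; rewrite HQ'; ring. }
assert (Hmass : (INR n - INR t) * q k + m <= INR t + 1).
{ apply Rle_trans with (rsum n q); [|exact Htot'].
  rewrite <- Hcard, <- Hold, Rmult_comm, <- rsum_scal, <- rsum_plus.
  apply rsum_le; intros i Hi; destruct (Q i) eqn:E.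
  - rewrite ind_true by reflexivity; specialize (Hmin' i Hi E); lra.
  - rewrite ind_false by discriminate; lra. }
(* Resource [k] is removed only after arrival [t], hence adjacent to it; pairing the two extends the
   matching [rho]. *)
exists A', (fun s => if Nat.eqb s t then k else rho s), Q'.
split; [unfold A'; rewrite length_app; simpl; lia|].
split; [exact HA'e|].
split.
{ intros s Hs; unfold A'; destruct (Nat.eqb_spec s t) as [->|Hne].
  - rewrite <- HA, nth_middle; unfold a, set_arrival; rewrite HQk; reflexivity.
  - rewrite app_nth1 by lia; apply Hrho; lia. }
split.
{ intros s s' Hs Hs'; destruct (Nat.eqb_spec s t) as [->|]; [lia|].
  destruct (Nat.eqb_spec s' t) as [->|]; [apply (HS k HQk); lia|apply Hinj; lia]. }
split.
{ unfold Q'; intros i Hi; apply andb_true_iff in Hi; destruct Hi as (Hi & Hik).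
  split; [apply HS, Hi|]; intros s Hs; destruct (Nat.eqb_spec s t) as [->|Hne].
  - intros ->; rewrite Nat.eqb_refl in Hik; discriminate.
  - apply (HS i Hi); lia. }
rewrite S_INR; split.
{ rewrite (rsum_ext n _ (fun i => ind (Q i = true) + -1 * ind (Some k = Some i)))
    by (intros i _; rewrite HQ'; ring).
  rewrite rsum_plus, (rsum_ind_option n (fun _ => -1)) by (intros i [= <-]; exact Hk).
  rewrite Hcard; simpl; ring. }
split; [exact Htot'|]; fold q; rewrite Hnew.
(* The first alternative rests on [q k <= 1], the second on [Hmass]. *)
destruct (Hb t Ht) as [H|H]; [lra|].
apply Rmult_le_reg_l with (INR n - INR t); [exact Hnt|].
eapply Rle_trans; [|exact H].
assert (0 <= INR n - INR t - 1).
{ assert (INR (S t) <= INR n) by (apply le_INR; lia); rewrite S_INR in *; lra. }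
assert ((INR n - INR t - 1) * m <= (INR n - INR t - 1) * beta t) by (apply Rmult_le_compat_l; lra).
lra.
Qed.

Lemma cv_perfect_matching n A rho rest h :
  h = map (fun s => (Some (rho s), true)) (seq 0 (length h)) ->
  (length h + length rest = length A)%nat -> rest = skipn (length h) A ->
  (forall s, (s < length A)%nat -> (rho s < n)%nat /\ nth s A no_edge (rho s) = Some 1) ->
  (forall s s', (s < s')%nat -> (s' < length A)%nat -> rho s <> rho s') ->
  cv (fun h => Some (rho (length h))) n (fun _ => 1) rest h = INR (length rest).
Proof.
revert h; induction rest as [|a rest IH]; intros h Hh Hl Hr Hrho Hinj; [reflexivity|].
simpl length in Hl; rewrite (skipn_nth no_edge) in Hr by lia; injection Hr as Ha Hr.
destruct (Hrho (length h) ltac:(lia)) as (H1 & H2).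
assert (Ht : taken h (rho (length h)) = false).
{ apply not_true_is_false; intros E; unfold taken in E; apply existsb_exists in E.
  destruct E as (x & Hx & E); rewrite Hh in Hx; apply in_map_iff in Hx.
  destruct Hx as (s & <- & Hs); apply in_seq in Hs; apply Nat.eqb_eq in E.
  apply (Hinj s (length h)); [lia|lia|congruence]. }
simpl cv; rewrite Ha, H2, (proj2 (Nat.ltb_lt _ _) H1), Ht; simpl andb; cbv iota.
rewrite IH; auto.
- simpl length; rewrite S_INR; ring.
- rewrite length_app, Nat.add_1_r, seq_S, map_app, <- Hh; reflexivity.
- rewrite length_app; simpl; lia.
- rewrite length_app, Nat.add_1_r; exact Hr.
Qed.

(** For [t <= n] this is the difference of harmonic numbers [H_n - H_(n-t)]. *)
Definition hsum (n t : nat) : R := rsum t (fun s => / (INR n - INR s)).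

Lemma ln_1p_le x : 0 < x -> ln (1 + x) <= x.
Proof.
intros Hx; rewrite <- (ln_exp x) at 2; apply Rlt_le, ln_increasing; [lra|].
apply exp_ineq1; lra.
Qed.

(** Each term [1 / (n - s)] is at least [ln (1 + 1 / (n - s))], and these logarithms telescope. *)
Lemma hsum_ge n t : (t <= n)%nat -> ln (INR n + 1) - ln (INR n + 1 - INR t) <= hsum n t.
Proof.
unfold hsum; induction t as [|t IH]; intros Ht.
- simpl; rewrite Rminus_0_r; lra.
- specialize (IH ltac:(lia)); rewrite S_INR; simpl rsum.
  assert (Hp : 0 < INR n - INR t) by (apply Rlt_0_minus, lt_INR; lia).
  assert (Hi : 0 < / (INR n - INR t)) by (apply Rinv_0_lt_compat; exact Hp).
  assert (H := ln_1p_le _ Hi).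
  assert (E : INR n + 1 - INR t = (INR n - INR t) * (1 + / (INR n - INR t))) by (field; lra).
  rewrite E, ln_mult in IH by lra.
  replace (INR n + 1 - (INR t + 1)) with (INR n - INR t) by ring; lra.
Qed.

(** Up to [tau], [beta] solves the averaging recursion of [adversary] with equality; afterwards it
    grows by the trivial 1 per removal. At time [n] every resource has been removed, so the removed
    mass is the whole value. *)
Lemma online_upper_bound alg n tau : valid_alg alg -> (tau <= n)%nat ->
  exists (I : inst) (pol : ClairPolicy), wf_inst I /\ decomposable I /\
    clair_value I pol = INR n /\
    online_value alg I <= INR n - (INR n - INR tau) * hsum n tau.
Proof.
intros Halg Htau.
pose (beta := fun t => if (t <=? tau)%nat then INR t - (INR n - INR t) * hsum n t
   else INR t - (INR n - INR tau) * hsum n tau).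
destruct (adversary alg n beta Halg) with (t := n) as
  (A & rho & Q & HA & HAe & Hrho & Hinj & HS & Hcard & _ & Hrem); auto.
- unfold beta, hsum; simpl; lra.
- intros t Ht; unfold beta; destruct (Nat.leb_spec (S t) tau) as [H|H].
  + rewrite (proj2 (Nat.leb_le _ _)) by lia; right.
    unfold hsum; rewrite S_INR; simpl rsum; right; field.
    assert (0 < INR n - INR t) by (apply Rlt_0_minus, lt_INR; lia); lra.
  + left; rewrite S_INR; destruct (Nat.leb_spec t tau) as [H'|H']; [|lra].
    assert (t = tau) by lia; subst t; lra.
- assert (Hrn : forall s, (s < n)%nat -> (rho s < n)%nat).
  { intros s Hs; apply (HAe (nth s A no_edge)) with 1; [apply nth_In; lia|auto]. }
  assert (HQ : forall i, (i < n)%nat -> ind (Q i = true) = 0).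
  { intros i Hi; apply Rle_antisym; [|apply ind_ge0].
    rewrite Rminus_diag in Hcard; rewrite <- Hcard.
    apply (rsum_term_le n (fun i => ind (Q i = true))); [exact Hi|intros; apply ind_ge0]. }
  exists (mkInst n (fun _ => 1) A), (fun h => Some (rho (length h))).
  split; [|split; [|split]].
  + split; simpl; [intros; lra|]; intros a Ha i p Hp.
    destruct (HAe a Ha i p Hp) as (Hi & ->); split; [exact Hi|lra].
  + exists (fun _ => 1), (fun _ => 1); simpl; split; [intros; lra|]; split; [intros; lra|].
    intros t i p Ht Hp; destruct (HAe _ (nth_In A no_edge Ht) i p Hp) as (_ & ->); ring.
  + transitivity (INR (length A)); [|rewrite HA; reflexivity].
    apply (cv_perfect_matching n A rho A []); [reflexivity|reflexivity|reflexivity| |].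
    * intros s Hs; rewrite HA in Hs; auto.
    * intros s s' Hs Hs'; apply Hinj; lia.
  + rewrite online_value_match_prob by exact Halg.
    rewrite (rsum_ext n _ (fun i => match_prob alg n A i * (1 - ind (Q i = true)))).
    2:{ intros i Hi; rewrite HQ by exact Hi; ring. }
    eapply Rle_trans; [exact Hrem|]; unfold beta.
    destruct (Nat.leb_spec n tau) as [H|H]; [|lra].
    assert (tau = n) by lia; subst; lra.
Qed.

(** The switch happens when [k], just above [n / e], resources remain: there [hsum] is about
    [ln (n / k)], close to 1, and the bound is [n - n / e] up to a constant. *)
Lemma online_upper_bound_exp alg n : valid_alg alg -> (2 <= n)%nat ->
  exists (I : inst) (pol : ClairPolicy), wf_inst I /\ decomposable I /\
    clair_value I pol = INR n /\
    online_value alg I <= (1 - exp (-1)) * INR n + 5.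
Proof.
intros Halg Hn.
assert (HE : 2 < exp 1 <= 3) by (split; [replace 2 with (1 + 1) by ring; apply exp_ineq1; lra|apply exp_le_3]).
assert (Hinv : exp (-1) * exp 1 = 1) by (rewrite <- exp_plus; replace (-1 + 1) with 0 by ring; apply exp_0).
assert (He := exp_m1_bounds).
assert (Hn2 : 2 <= INR n) by (replace 2 with (INR 2) by (simpl; ring); apply le_INR; exact Hn).
set (x := INR n * exp (-1)).
assert (Hx : 0 < x) by (apply Rmult_lt_0_compat; lra).
assert (Hx2 : x <= INR n / 2) by (unfold x; nra).
destruct (archimed x) as (U1 & U2).
assert (Uz : (0 < up x)%Z) by (apply lt_IZR; lra).
pose (k := Z.to_nat (up x)).
assert (Hk : INR k = IZR (up x)) by (unfold k; rewrite INR_IZR_INZ, Z2Nat.id by lia; reflexivity).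
assert (Hkn : (k <= n)%nat) by (apply INR_le; lra).
destruct (online_upper_bound alg n (n - k)) as (I & pol & H1 & H2 & H3 & H4); [exact Halg|lia|].
exists I, pol; do 3 (split; [assumption|]).
eapply Rle_trans; [exact H4|].
assert (Hh := hsum_ge n (n - k) ltac:(lia)); rewrite minus_INR in * by exact Hkn.
replace (INR n - (INR n - INR k)) with (INR k) by ring.
replace (INR n + 1 - (INR n - INR k)) with (INR k + 1) in Hh by ring.
set (s := hsum n (n - k)) in *.
(* Since [e <= 3], [INR k + 1 <= x + 2 <= exp (-1) * (INR n + 6)]; the 5 is the excess of
   [INR n + 6] over [INR n + 1]. *)
assert (Hln : ln (INR k + 1) <= ln (INR n + 1) - 1 + 5 / (INR n + 1)).
{ apply Rle_trans with (ln (exp (-1) * ((INR n + 1) * (1 + 5 / (INR n + 1))))).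
  - assert (Hle : INR k + 1 <= exp (-1) * ((INR n + 1) * (1 + 5 / (INR n + 1)))).
    { replace ((INR n + 1) * (1 + 5 / (INR n + 1))) with (INR n + 6) by (field; lra).
      assert (1 <= exp (-1) * 3) by (rewrite <- Hinv; apply Rmult_le_compat_l; lra).
      assert (Hxe : x = INR n * exp (-1)) by reflexivity; lra. }
    destruct Hle as [Hlt|Heq]; [apply Rlt_le, ln_increasing; lra|rewrite Heq; lra].
  - assert (Hp : 0 < 5 / (INR n + 1)) by (apply Rdiv_lt_0_compat; lra).
    rewrite !ln_mult, ln_exp by (try apply Rmult_lt_0_compat; lra).
    assert (L := ln_1p_le _ Hp); lra. }
assert (Hs : 1 - 5 / (INR n + 1) <= s) by lra.
assert (Hd : 5 / (INR n + 1) * (INR n + 1) = 5) by (field; lra).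
assert (Hd0 : 0 < 5 / (INR n + 1)) by (apply Rdiv_lt_0_compat; lra).
set (d := 5 / (INR n + 1)) in *.
assert (Hs0 : 0 <= s).
{ apply rsum_ge0; intros j Hj; left; apply Rinv_0_lt_compat, Rlt_0_minus, lt_INR; lia. }
assert (x * s <= INR k * s) by (apply Rmult_le_compat_r; lra).
assert (x * (1 - d) <= x * s) by (apply Rmult_le_compat_l; lra).
assert (x * d <= 5) by (unfold x in *; nra).
unfold x in *; lra.
Qed.

Lemma no_online_alg_better alg c : valid_alg alg -> 1 - exp (-1) < c ->
  exists (I : inst) (pol : ClairPolicy), wf_inst I /\ decomposable I /\
    online_value alg I < c * clair_value I pol.
Proof.
intros Halg Hc.
(* With this [N] the additive constant 5 is smaller than [N] times the gap between [c] and
   [1 - exp (-1)]. *)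
destruct (archimed_cor1 ((c - (1 - exp (-1))) / 5)) as (N & HN1 & HN2); [lra|].
assert (HNp := lt_0_INR N HN2).
destruct (online_upper_bound_exp alg (N + 2) Halg ltac:(lia)) as (I & pol & H1 & H2 & H3 & H4).
exists I, pol; do 2 (split; [assumption|]); rewrite H3.
eapply Rle_lt_trans; [exact H4|].
rewrite plus_INR; change (INR 2) with 2.
apply (Rmult_lt_compat_r (5 * INR N)) in HN1; [|lra].
replace (/ INR N * (5 * INR N)) with 5 in HN1 by (field; lra).
nra.
Qed.

Theorem theorem1 :
  (forall I : inst, wf_inst I -> decomposable I ->
     exists v : R,
       cube_int (nI I) (fun y => online_value (greedy_alg y) I) v /\
       (forall pol : ClairPolicy, (1 - exp (-1)) * clair_value I pol <= v) /\
       (forall pol : OffPolicy, (1 - exp (-1)) * offline_value I pol <= v))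
  /\
  (forall alg : OnlineAlg, valid_alg alg ->
     forall c : R, 1 - exp (-1) < c ->
       (exists (I : inst) (pol : ClairPolicy),
          wf_inst I /\ decomposable I /\
          online_value alg I < c * clair_value I pol) /\
       (exists (I : inst) (pol : OffPolicy),
          wf_inst I /\ decomposable I /\
          online_value alg I < c * offline_value I pol)).
Proof.
split.
- intros I Hwf Hdec; destruct (greedy_competitive I Hwf Hdec) as (v & Hv & Hoff).
  exists v; split; [exact Hv|]; split; [|exact Hoff].
  intros pol; rewrite <- offline_value_in_order; apply Hoff.
- intros alg Halg c Hc.
  destruct (no_online_alg_better alg c Halg Hc) as (I & pol & Hwf & Hdec & Hlt).
  split; [exists I, pol; auto|].
  exists I, (in_order_policy pol); rewrite offline_value_in_order; auto.
Qed.
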